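(* Let $\mathcal C$ and $\mathcal D$ be pivotal finite tensor categories and $F\colon\mathcal C\to\mathcal D$ a pivotal tensor functor. (i) If $F$ is $\otimes$-Frobenius, then the lax monoidal functor $F^{\mathrm{ra}}\colon\mathcal D\to\mathcal C$ preserves exact symmetric Frobenius algebras: if $A\in\mathcal D$ is an exact algebra admitting a symmetric Frobenius structure, then the algebra $F^{\mathrm{ra}}(A)\in\mathcal C$ is exact and admits a symmetric Frobenius structure. (ii) If $\mathcal C$ is endowed with a braiding, $F$ has the structure of a central functor and $F$ is Frobenius, then $F^{\mathrm{ra}}(\mathbb 1)$ is a haploid commutative exact symmetric Frobenius algebra in $\mathcal C$.
   Context: Work over an algebraically closed field $\Bbbk$. A finite tensor category is a finite $\Bbbk$-linear abelian rigid monoidal category with bilinear tensor product and $\mathrm{End}(\mathbb 1)\cong\Bbbk$; a tensor functor is an exact $\Bbbk$-linear strong monoidal functor. Right duals: $\mathrm{ev}_c\colon c^\vee\otimes c\to\mathbb 1$, $\mathrm{coev}_c\colon\mathbb 1\to c\otimes c^\vee$; left duals: $c\otimes{}^\vee c\to\mathbb 1$, $\widetilde{\mathrm{coev}}_c\colon\mathbb 1\to{}^\vee c\otimes c$. A pivotal structure is a monoidal natural isomorphism $\mathfrak p\colon\mathrm{id}\cong(-)^{\vee\vee}$. $F$ is pivotal if $\zeta_c^\vee\circ\mathfrak p^{\mathcal D}_{F(c)}=\zeta_{c^\vee}\circ F(\mathfrak p^{\mathcal C}_c)$ with $\zeta_c\colon F(c^\vee)\cong F(c)^\vee$ canonical.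 $F^{\mathrm{la}},F^{\mathrm{ra}}$ are adjoints; $F^{\mathrm{ra}}$ has the lax monoidal structure induced from $F$, hence maps algebras to algebras. $F$ is Frobenius if $F^{\mathrm{la}}\cong F^{\mathrm{ra}}$ as functors; $F$ is $\otimes$-Frobenius if $F^{\mathrm{la}}\cong F^{\mathrm{ra}}$ as $\mathcal C$-bimodule functors ${}_F\mathcal D_F\to\mathcal C$, where ${}_F\mathcal D_F$ is $\mathcal D$ with $\mathcal C$-bimodule action $F(c)\otimes d\otimes F(c')$ and the adjoints carry the bimodule structures induced from $F$. A central structure on $F$ (with $\mathcal C$ braided) is a braided tensor functor $\widetilde F\colon\mathcal C\to\mathcal Z(\mathcal D)$ to the Drinfeld center with a monoidal isomorphism $F\cong U\circ\widetilde F$, $U$ the forgetful functor. An algebra $A$ in $\mathcal C$ is exact if the left $\mathcal C$-module category of right $A$-modules is exact (a module category is exact if $p\triangleright m$ is projective for every projective $p$ and every $m$); it is haploid if $\dim_\Bbbk\mathrm{Hom}(\mathbb 1,A)=1$. A Frobenius algebra is $(A,m,u,\Delta,\varepsilon)$ with $(A,m,u)$ an algebra, $(A,\Delta,\varepsilon)$ a coalgebra and $(m\otimes\mathrm{id})(\mathrm{id}\otimes\Delta)=\Delta m=(\mathrm{id}\otimes m)(\Delta\otimes\mathrm{id})$; in a pivotal category it is symmetric if $(\varepsilon m\otimes\mathrm{id}_{A^\vee})(\mathrm{id}_A\otimes\mathrm{coev}_A)=(\mathfrak p_{{}^\vee A}\otimes\varepsilon m)(\widetilde{\mathrm{coev}}_A\otimes\mathrm{id}_A)\colon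 A\to A^\vee$. *)

(* Defs.v *)
From HB Require Import structures.
From mathcomp Require Import all_boot all_algebra.
From mathcomp Require Import boolp.

Set Implicit Arguments.
Unset Strict Implicit.
Unset Printing Implicit Defensive.

Import GRing.Theory.
Local Open Scope ring_scope.

Declare Scope cat_scope.
Delimit Scope cat_scope with cat.
Open Scope cat_scope.

(* Hom-spaces are [vectType]s, so local finiteness is built in. *)
Record lincat (k : fieldType) := LinCat {
  ob :> Type;
  hom : ob -> ob -> vectType k;
  idm : forall x, hom x x;
  comp : forall x y z, hom y z -> hom x y -> hom x z;
  compA : forall x y z w (h : hom z w) (g : hom y z) (f : hom x y),
    comp h (comp g f) = comp (comp h g) f;
  comp1m : forall x y (f : hom x y), comp (idm y) f = f;
  compm1 : forall x y (f : hom x y), comp f (idm x) = f;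
  comp_linl : forall x y z (f : hom x y), linear (fun g : hom y z => comp g f);
  comp_linr : forall x y z (g : hom y z), linear (fun f : hom x y => comp g f)
}.
Arguments hom {k l} x y.
Arguments idm {k l} x.
Arguments comp {k l x y z} g f : rename.

Notation "g ∘ f" := (comp g f) (at level 40, left associativity) : cat_scope.

Section LinCatTheory.
Variables (k : fieldType) (C : lincat k).
Implicit Types x y z w : C.

Definition is_inverse x y (f : hom x y) (g : hom y x) : Prop :=
  g ∘ f = idm x /\ f ∘ g = idm y.

Definition is_iso x y (f : hom x y) : Prop := exists g, is_inverse f g.

Definition isomorphic x y : Prop := exists f : hom x y, is_iso f.

Definition is_mono x y (f : hom x y) : Prop :=
  forall z (g h : hom z x), f ∘ g = f ∘ h -> g = h.

Definition is_epi x y (f : hom x y) : Prop :=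
  forall z (g h : hom y z), g ∘ f = h ∘ f -> g = h.

Definition is_zero_object x : Prop :=
  forall y, (forall f : hom x y, f = 0) /\ (forall f : hom y x, f = 0).

Definition is_biproduct x y z : Prop :=
  exists (i : hom x z) (j : hom y z) (p : hom z x) (q : hom z y),
    [/\ p ∘ i = idm x, q ∘ j = idm y, p ∘ j = 0, q ∘ i = 0
      & i ∘ p + j ∘ q = idm z].

Definition is_kernel x y z (f : hom y z) (i : hom x y) : Prop :=
  f ∘ i = 0 /\
  forall w (g : hom w y), f ∘ g = 0 -> exists! h : hom w x, i ∘ h = g.

Definition is_cokernel x y z (f : hom x y) (p : hom y z) : Prop :=
  p ∘ f = 0 /\
  forall w (g : hom y w), g ∘ f = 0 -> exists! h : hom z w, h ∘ p = g.

Definition short_exact x y z (i : hom x y) (p : hom y z) : Prop :=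
  is_kernel p i /\ is_cokernel i p.

Definition is_abelian : Prop :=
  (exists x, is_zero_object x) /\
  (forall x y, exists z, is_biproduct x y z) /\
  (forall y z (f : hom y z), exists x (i : hom x y), is_kernel f i) /\
  (forall x y (f : hom x y), exists z (p : hom y z), is_cokernel f p) /\
  (forall x y (i : hom x y),
      is_mono i -> exists z (p : hom y z), is_kernel p i) /\
  (forall y z (p : hom y z),
      is_epi p -> exists x (i : hom x y), is_cokernel i p).

Definition is_simple x : Prop :=
  ~ is_zero_object x /\
  forall y (i : hom y x), is_mono i -> is_zero_object y \/ is_iso i.

Inductive finite_length : C -> Prop :=
| finite_length0 x : is_zero_object x -> finite_length x
| finite_lengthS x y z (i : hom x y) (p : hom y z) :
    finite_length x -> is_simple z -> short_exact i p -> finite_length y.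

Definition is_projective x : Prop :=
  forall y z (p : hom y z) (f : hom x z),
    is_epi p -> exists g : hom x y, p ∘ g = f.

Definition is_finite_abelian : Prop :=
  is_abelian /\
  (forall x, finite_length x) /\
  (exists (n : nat) (s : 'I_n -> C),
      forall x, is_simple x -> exists i, isomorphic x (s i)) /\
  (forall x, exists y (p : hom y x), is_projective y /\ is_epi p).

End LinCatTheory.

Record functor (k : fieldType) (C D : lincat k) := Functor {
  fob :> C -> D;
  fmap : forall x y : C, hom x y -> hom (fob x) (fob y);
  fmap1 : forall x, fmap (idm x) = idm (fob x);
  fmapM : forall x y z (g : hom y z) (f : hom x y),
    fmap (g ∘ f) = fmap g ∘ fmap f;
  fmap_lin : forall x y, linear (@fmap x y)
}.
Arguments fmap {k C D} F {x y} f : rename.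

Section Functors.
Variables (k : fieldType).

Definition fcomp (C D E : lincat k) (G : functor D E) (F : functor C D) :
  functor C E.
Proof.
refine (@Functor k C E (fun x => G (F x)) (fun x y f => fmap G (fmap F f)) _ _ _).
- by move=> x; rewrite !fmap1.
- by move=> x y z g f; rewrite !fmapM.
- by move=> x y a f g; rewrite !fmap_lin.
Defined.

Definition is_natural (C D : lincat k) (F G : functor C D)
    (t : forall x, hom (F x) (G x)) : Prop :=
  forall x y (f : hom x y), t y ∘ fmap F f = fmap G f ∘ t x.

Definition is_natural_iso (C D : lincat k) (F G : functor C D)
    (t : forall x, hom (F x) (G x)) : Prop :=
  is_natural t /\ forall x, is_iso (t x).

Definition is_exact (C D : lincat k) (F : functor C D) : Prop :=
  forall x y z (i : hom x y) (p : hom y z),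
    short_exact i p -> short_exact (fmap F i) (fmap F p).

(* [L] is left adjoint to [R]. *)
Record adjunction (C D : lincat k) (L : functor C D) (R : functor D C) :=
  Adjunction {
  aunit : forall x, hom x (R (L x));
  acounit : forall y, hom (L (R y)) y;
  aunit_nat : forall x x' (f : hom x x'),
    aunit x' ∘ f = fmap R (fmap L f) ∘ aunit x;
  acounit_nat : forall y y' (g : hom y y'),
    acounit y' ∘ fmap L (fmap R g) = g ∘ acounit y;
  adj_triL : forall x, acounit (L x) ∘ fmap L (aunit x) = idm (L x);
  adj_triR : forall y, fmap R (acounit y) ∘ aunit (R y) = idm (R y)
}.

End Functors.
Arguments aunit {k C D L R} a x.
Arguments acounit {k C D L R} a y.

Section Transpose.
Variables (k : fieldType) (C D : lincat k) (L : functor C D) (R : functor D C).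
Variable a : adjunction L R.

Definition transR x y (f : hom (L x) y) : hom x (R y) := fmap R f ∘ aunit a x.
Definition transL x y (g : hom x (R y)) : hom (L x) y := acounit a y ∘ fmap L g.

Lemma transK x y (f : hom (L x) y) : transL (transR f) = f.
Proof.
rewrite /transL /transR fmapM compA acounit_nat -compA adj_triL.
exact: compm1.
Qed.

Lemma transL_inj x y (g h : hom x (R y)) : transL g = transL h -> g = h.
Proof.
move=> E; have K g' : transR (transL g') = g' :> hom x (R y).
  by rewrite /transL /transR fmapM -compA -aunit_nat compA adj_triR comp1m.
by rewrite -(K g) -(K h) E.
Qed.

End Transpose.

Record moncat (k : fieldType) := MonCat {
  mcat :> lincat k;
  tobj : mcat -> mcat -> mcat;
  tmor : forall x y x' y' : mcat,
    hom x y -> hom x' y' -> hom (tobj x x') (tobj y y');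
  tunit : mcat;
  tmor1 : forall x x', tmor (idm x) (idm x') = idm (tobj x x');
  tmorM : forall x y z x' y' z' (g : hom y z) (f : hom x y)
      (g' : hom y' z') (f' : hom x' y'),
    tmor (g ∘ f) (g' ∘ f') = tmor g g' ∘ tmor f f';
  tmor_linl : forall x y x' y' (f' : hom x' y'),
    linear (fun f : hom x y => tmor f f');
  tmor_linr : forall x y x' y' (f : hom x y),
    linear (fun f' : hom x' y' => tmor f f');
  assoc : forall x y z, hom (tobj (tobj x y) z) (tobj x (tobj y z));
  assocV : forall x y z, hom (tobj x (tobj y z)) (tobj (tobj x y) z);
  lu : forall x, hom (tobj tunit x) x;
  luV : forall x, hom x (tobj tunit x);
  ru : forall x, hom (tobj x tunit) x;
  ruV : forall x, hom x (tobj x tunit);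
  assocP : forall x y z, is_inverse (assoc x y z) (assocV x y z);
  luP : forall x, is_inverse (lu x) (luV x);
  ruP : forall x, is_inverse (ru x) (ruV x);
  assoc_nat : forall x y x' y' x'' y''
      (f : hom x y) (f' : hom x' y') (f'' : hom x'' y''),
    assoc y y' y'' ∘ tmor (tmor f f') f'' =
    tmor f (tmor f' f'') ∘ assoc x x' x'';
  lu_nat : forall x y (f : hom x y), lu y ∘ tmor (idm tunit) f = f ∘ lu x;
  ru_nat : forall x y (f : hom x y), ru y ∘ tmor f (idm tunit) = f ∘ ru x;
  pentagon : forall x y z w,
    assoc x y (tobj z w) ∘ assoc (tobj x y) z w =
    tmor (idm x) (assoc y z w) ∘ assoc x (tobj y z) w ∘
      tmor (assoc x y z) (idm w);
  triangle : forall x y,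
    tmor (idm x) (lu y) ∘ assoc x tunit y = tmor (ru x) (idm y)
}.
Arguments tobj {k m} x y : rename.
Arguments tmor {k m x y x' y'} f f' : rename.
Arguments tunit {k m}.
Arguments assoc {k m} x y z : rename.
Arguments assocV {k m} x y z : rename.
Arguments lu {k m} x : rename.
Arguments luV {k m} x : rename.
Arguments ru {k m} x : rename.
Arguments ruV {k m} x : rename.

Notation "x ⊗ y" := (tobj x y) (at level 38, left associativity) : cat_scope.
Notation "f ⊗₁ g" := (tmor f g) (at level 38, left associativity) : cat_scope.
Notation "f ▹ x" := (tmor f (idm x)) (at level 38, left associativity) : cat_scope.
Notation "x ◃ f" := (tmor (idm x) f) (at level 38, left associativity) : cat_scope.
Notation "𝟙" := tunit : cat_scope.

Section MonCatTheory.
Variables (k : fieldType) (C : moncat k).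
Implicit Types x y z w : C.

Lemma assocK x y z : assocV x y z ∘ assoc x y z = idm _.
Proof. by case: (assocP x y z). Qed.
Lemma assocVK x y z : assoc x y z ∘ assocV x y z = idm _.
Proof. by case: (assocP x y z). Qed.
Lemma luK x : luV x ∘ lu x = idm _. Proof. by case: (luP x). Qed.
Lemma luVK x : lu x ∘ luV x = idm _. Proof. by case: (luP x). Qed.
Lemma ruK x : ruV x ∘ ru x = idm _. Proof. by case: (ruP x). Qed.
Lemma ruVK x : ru x ∘ ruV x = idm _. Proof. by case: (ruP x). Qed.

Lemma iso_mono x y (f : hom x y) : is_iso f -> is_mono f.
Proof.
by case=> g [gf _] z a b E; rewrite -[a]comp1m -[b]comp1m -gf -!compA E.
Qed.
Lemma iso_epi x y (f : hom x y) : is_iso f -> is_epi f.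
Proof.
by case=> g [_ fg] z a b E; rewrite -[a]compm1 -[b]compm1 -fg !compA E.
Qed.
Lemma is_iso_id x : is_iso (idm x).
Proof. by exists (idm x); split; rewrite comp1m. Qed.
Lemma is_iso_comp x y z (g : hom y z) (f : hom x y) :
  is_iso g -> is_iso f -> is_iso (g ∘ f).
Proof.
case=> g' [g1 g2] [f' [f1 f2]]; exists (f' ∘ g'); split.
  by rewrite compA -(compA f') g1 compm1.
by rewrite compA -(compA g) f2 compm1.
Qed.
Lemma is_iso_tmor x y x' y' (f : hom x y) (f' : hom x' y') :
  is_iso f -> is_iso f' -> is_iso (f ⊗₁ f').
Proof.
case=> g [f1 f2] [g' [f1' f2']]; exists (g ⊗₁ g').
by split; rewrite -tmorM ?f1 ?f1' ?f2 ?f2' tmor1.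
Qed.
Lemma is_iso_assoc x y z : is_iso (assoc x y z).
Proof. by exists (assocV x y z); apply: assocP. Qed.
Lemma is_iso_assocV x y z : is_iso (assocV x y z).
Proof. by exists (assoc x y z); split; case: (assocP x y z). Qed.
Lemma is_iso_lu x : is_iso (lu x). Proof. by exists (luV x); apply: luP. Qed.
Lemma is_iso_ru x : is_iso (ru x). Proof. by exists (ruV x); apply: ruP. Qed.
Lemma is_iso_luV x : is_iso (luV x).
Proof. by exists (lu x); split; case: (luP x). Qed.
Lemma is_iso_ruV x : is_iso (ruV x).
Proof. by exists (ru x); split; case: (ruP x). Qed.

Lemma wl_inj x y (f g : hom x y) : 𝟙 ◃ f = 𝟙 ◃ g -> f = g.
Proof. by move=> E; apply: (iso_epi (is_iso_lu x)); rewrite -!lu_nat E. Qed.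
Lemma wr_inj x y (f g : hom x y) : f ▹ 𝟙 = g ▹ 𝟙 -> f = g.
Proof. by move=> E; apply: (iso_epi (is_iso_ru x)); rewrite -!ru_nat E. Qed.

Lemma wlM x y z w (g : hom y z) (f : hom x y) : w ◃ (g ∘ f) = w ◃ g ∘ (w ◃ f).
Proof. by rewrite -tmorM comp1m. Qed.
Lemma wrM x y z w (g : hom y z) (f : hom x y) : (g ∘ f) ▹ w = g ▹ w ∘ (f ▹ w).
Proof. by rewrite -tmorM comp1m. Qed.
Lemma exch x y x' y' (f : hom x y) (f' : hom x' y') :
  f ▹ y' ∘ (x ◃ f') = y ◃ f' ∘ (f ▹ x').
Proof. by rewrite -!tmorM !comp1m !compm1. Qed.
Lemma tmorE x y x' y' (f : hom x y) (f' : hom x' y') :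
  f ⊗₁ f' = f ▹ y' ∘ (x ◃ f').
Proof. by rewrite -tmorM comp1m compm1. Qed.

Lemma luA x y : lu (x ⊗ y) ∘ assoc 𝟙 x y = lu x ▹ y.
Proof.
apply: wl_inj; rewrite wlM.
apply: (iso_epi (f := assoc 𝟙 (𝟙 ⊗ x) y ∘ (assoc 𝟙 𝟙 x ▹ y))).
  by apply: is_iso_comp (is_iso_assoc _ _ _) (is_iso_tmor (is_iso_assoc _ _ _) (is_iso_id _)).
rewrite -compA (compA (𝟙 ◃ assoc _ _ _)) -pentagon compA triangle.
rewrite -(tmor1 x y) -assoc_nat.
rewrite (compA (𝟙 ◃ (_ ▹ _))) -assoc_nat -compA -wrM triangle //.
Qed.

Lemma ruA x y : x ◃ ru y ∘ assoc x y 𝟙 = ru (x ⊗ y).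
Proof.
apply: wr_inj; rewrite wrM.
apply: (iso_mono (is_iso_assoc _ _ _)).
rewrite compA assoc_nat -triangle -triangle wlM.
rewrite -(tmor1 x y) (compA (assoc _ _ _)) assoc_nat -(compA _ (assoc x y (𝟙 ⊗ 𝟙))) pentagon.
by rewrite !compA.
Qed.

Lemma lu_unit : lu (𝟙 : C) = ru 𝟙.
Proof.
apply: wr_inj; rewrite -triangle -luA; congr (_ ∘ _).
by apply: (iso_mono (is_iso_lu 𝟙)); rewrite lu_nat.
Qed.

Lemma pentagonA x y z w (v : C) (h : hom v (x ⊗ y ⊗ z ⊗ w)) :
  assoc x y (z ⊗ w) ∘ (assoc (x ⊗ y) z w ∘ h) =
  (x ◃ assoc y z w) ∘ (assoc x (y ⊗ z) w ∘ ((assoc x y z ▹ w) ∘ h)).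
Proof. by rewrite compA pentagon -!compA. Qed.

End MonCatTheory.

Record laxmon (k : fieldType) (C D : moncat k) := LaxMon {
  lfun :> functor C D;
  F2 : forall x y, hom (lfun x ⊗ lfun y) (lfun (x ⊗ y));
  F0 : hom 𝟙 (lfun 𝟙);
  F2_nat : forall x y x' y' (f : hom x y) (f' : hom x' y'),
    F2 y y' ∘ (fmap lfun f ⊗₁ fmap lfun f') = fmap lfun (f ⊗₁ f') ∘ F2 x x';
  F2_assoc : forall x y z,
    fmap lfun (assoc x y z) ∘ F2 (x ⊗ y) z ∘ (F2 x y ▹ lfun z) =
    F2 x (y ⊗ z) ∘ (lfun x ◃ F2 y z) ∘ assoc (lfun x) (lfun y) (lfun z);
  F2_lu : forall x, fmap lfun (lu x) ∘ F2 𝟙 x ∘ (F0 ▹ lfun x) = lu (lfun x);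
  F2_ru : forall x, fmap lfun (ru x) ∘ F2 x 𝟙 ∘ (lfun x ◃ F0) = ru (lfun x)
}.
Arguments F2 {k C D} F x y : rename.
Arguments F0 {k C D} F : rename.

Record tensor_functor (k : fieldType) (C D : moncat k) := TensorFunctor {
  tlax :> laxmon C D;
  F2V : forall x y, hom (tlax (x ⊗ y)) (tlax x ⊗ tlax y);
  F0V : hom (tlax 𝟙) 𝟙;
  F2P : forall x y, is_inverse (F2 tlax x y) (F2V x y);
  F0P : is_inverse (F0 tlax) F0V;
  tf_exact : is_exact tlax
}.
Arguments F2V {k C D} F x y : rename.
Arguments F0V {k C D} F : rename.

Section Monoidal.
Variables (k : fieldType).

Definition laxcomp (C D E : moncat k) (G : laxmon D E) (F : laxmon C D) :
  laxmon C E.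
Proof.
refine (@LaxMon k C E (fcomp G F)
  (fun x y => fmap G (F2 F x y) ∘ F2 G (F x) (F y))
  (fmap G (F0 F) ∘ F0 G) _ _ _ _) => /=.
- move=> x y x' y' f f'.
  by rewrite -compA F2_nat !compA -!fmapM F2_nat.
- move=> x y z; rewrite !wrM !wlM -!compA.
  have h := F2_nat G (F2 F x y) (idm (F z)); rewrite fmap1 in h.
  rewrite (compA (F2 G _ _) (fmap G _ ⊗₁ _)) h.
  have h' := F2_nat G (idm (F x)) (F2 F y z); rewrite fmap1 in h'.
  rewrite (compA (F2 G _ _) (_ ⊗₁ fmap G _)) h'.
  by rewrite !compA -!fmapM F2_assoc !fmapM -!compA (compA (fmap G (assoc _ _ _)))
             F2_assoc -!compA.
- move=> x; rewrite wrM -!compA.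
  have h := F2_nat G (F0 F) (idm (F x)); rewrite fmap1 in h.
  by rewrite (compA (F2 G _ _) (fmap G _ ⊗₁ _)) h !compA -!fmapM F2_lu F2_lu.
- move=> x; rewrite wlM -!compA.
  have h := F2_nat G (idm (F x)) (F0 F); rewrite fmap1 in h.
  by rewrite (compA (F2 G _ _) (_ ⊗₁ fmap G _)) h !compA -!fmapM F2_ru F2_ru.
Defined.

Definition is_monoidal_iso (C D : moncat k) (F G : laxmon C D)
    (t : forall x, hom (F x) (G x)) : Prop :=
  [/\ is_natural_iso t,
      forall x y, t (x ⊗ y) ∘ F2 F x y = F2 G x y ∘ (t x ⊗₁ t y)
    & t 𝟙 ∘ F0 F = F0 G].

Section RightAdjoint.
Variables (C D : moncat k) (F : tensor_functor C D) (R : functor D C).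
Variable a : adjunction F R.

(* The doctrinal-adjunction lax structure on a right adjoint. *)
Definition ra_F2 (x y : D) : hom (R x ⊗ R y) (R (x ⊗ y)) :=
  transR a ((acounit a x ⊗₁ acounit a y) ∘ F2V F (R x) (R y)).
Definition ra_F0 : hom 𝟙 (R 𝟙) := transR a (F0V F).

Lemma ra_F2E x y : acounit a (x ⊗ y) ∘ fmap F (ra_F2 x y) =
  (acounit a x ⊗₁ acounit a y) ∘ F2V F (R x) (R y).
Proof. exact: (transK a). Qed.
Lemma ra_F0E : acounit a 𝟙 ∘ fmap F ra_F0 = F0V F.
Proof. exact: (transK a). Qed.

Lemma F2VK x y : F2 F x y ∘ F2V F x y = idm _.
Proof. by case: (F2P F x y). Qed.
Lemma F2K x y : F2V F x y ∘ F2 F x y = idm _.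
Proof. by case: (F2P F x y). Qed.
Lemma F0VK : F0 F ∘ F0V F = idm _.
Proof. by case: (F0P F). Qed.
Lemma is_iso_F2 x y : is_iso (F2 F x y).
Proof. by exists (F2V F x y); apply: F2P. Qed.

Lemma F2V_nat x y x' y' (f : hom x y) (f' : hom x' y') :
  F2V F y y' ∘ fmap F (f ⊗₁ f') = (fmap F f ⊗₁ fmap F f') ∘ F2V F x x'.
Proof.
apply: (iso_mono (is_iso_F2 y y')).
by rewrite !compA F2VK comp1m F2_nat -compA F2VK compm1.
Qed.

Lemma F2V_assoc x y z :
  assoc (F x) (F y) (F z) ∘ (F2V F x y ▹ F z) ∘ F2V F (x ⊗ y) z =
  (F x ◃ F2V F y z) ∘ F2V F x (y ⊗ z) ∘ fmap F (assoc x y z).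
Proof.
have E := F2_assoc F x y z.
apply: (iso_mono (f := F2 F x (y ⊗ z) ∘ (F x ◃ F2 F y z))).
  apply: is_iso_comp (is_iso_F2 _ _) _.
  exact: is_iso_tmor (is_iso_id _) (is_iso_F2 _ _).
rewrite !compA -E.
rewrite -(compA (F2 F x (y ⊗ z)) (_ ◃ _)) -wlM F2VK tmor1 compm1 F2VK comp1m.
by rewrite -!compA (compA (_ ▹ _)) -wrM F2VK tmor1 comp1m F2VK compm1.
Qed.

Lemma F2V_lu x : lu (F x) ∘ (F0V F ▹ F x) ∘ F2V F 𝟙 x = fmap F (lu x).
Proof.
rewrite -(F2_lu F) -!compA (compA (_ ▹ _)) -wrM F0VK tmor1 comp1m F2VK compm1 //.
Qed.

Lemma F2V_ru x : ru (F x) ∘ (F x ◃ F0V F) ∘ F2V F x 𝟙 = fmap F (ru x).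
Proof.
rewrite -(F2_ru F) -!compA (compA (_ ◃ _)) -wlM F0VK tmor1 comp1m F2VK compm1 //.
Qed.

Definition ra_laxmon : laxmon D C.
Proof.
refine (@LaxMon k D C R ra_F2 ra_F0 _ _ _ _).
all: move: ra_F2 ra_F0 ra_F2E ra_F0E => G2 G0 G2E G0E.
- move=> x y x' y' f f'; apply: (transL_inj (a := a)); rewrite /transL !fmapM.
  rewrite !compA G2E -compA F2V_nat !compA -tmorM !acounit_nat.
  by rewrite -(compA _ (acounit a _)) G2E compA -tmorM.
- move=> x y z; apply: (transL_inj (a := a)); rewrite /transL !fmapM !compA.
  rewrite acounit_nat -(compA _ (acounit a _)) G2E.
  rewrite G2E -!compA F2V_nat fmap1 (compA (_ ⊗₁ _) (_ ⊗₁ _)) -tmorM G2E compm1.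
  rewrite -[X in _ ⊗₁ X]compm1 tmorM !compA assoc_nat.
  rewrite -(compA _ (F2V F (R x) (R (y ⊗ z)))) F2V_nat fmap1 compA -tmorM compm1.
  rewrite G2E -[X in X ⊗₁ (_ ∘ _)]compm1 tmorM -!compA; congr (_ ∘ _).
  by rewrite compA F2V_assoc compA.
- move=> x; apply: (transL_inj (a := a)); rewrite /transL !fmapM !compA.
  rewrite acounit_nat -(compA _ (acounit a _)) G2E -!compA F2V_nat fmap1.
  rewrite (compA (_ ⊗₁ _)) -tmorM G0E compm1 -[F0V F]comp1m -[acounit a x]compm1.
  by rewrite tmorM !compA lu_nat compm1 -!compA (compA (lu _)) F2V_lu.
- move=> x; apply: (transL_inj (a := a)); rewrite /transL !fmapM !compA.
  rewrite acounit_nat -(compA _ (acounit a _)) G2E -!compA F2V_nat fmap1.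
  rewrite (compA (_ ⊗₁ _)) -tmorM G0E compm1 -[F0V F]comp1m -[acounit a x]compm1.
  by rewrite tmorM !compA ru_nat compm1 -!compA (compA (ru _)) F2V_ru.
Defined.

End RightAdjoint.
End Monoidal.

(* A right dual [x^∨] with [ev : x^∨ ⊗ x -> 𝟙], [coev : 𝟙 -> x ⊗ x^∨]. *)
Record dual_data (k : fieldType) (C : moncat k) (x : C) := DualData {
  dob : C;
  ev : hom (dob ⊗ x) 𝟙;
  coev : hom 𝟙 (x ⊗ dob)
}.
Arguments ev {k C x} d : rename.
Arguments coev {k C x} d : rename.

Section Duals.
Variables (k : fieldType) (C : moncat k).

Definition is_dual (x : C) (d : dual_data x) : Prop :=
  (x ◃ ev d) ∘ assoc x (dob d) x ∘ (coev d ▹ x) = ruV x ∘ lu x /\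
  (ev d ▹ dob d) ∘ assocV (dob d) x (dob d) ∘ (dob d ◃ coev d) =
    luV (dob d) ∘ ru (dob d).

(* The dual morphism of [f : x -> y] for given duals of [x] and [y]; at
   [f = idm x] it compares two duals of [x]. *)
Definition mate (x y : C) (dx : dual_data x) (dy : dual_data y) (f : hom x y) :
    hom (dob dy) (dob dx) :=
  lu (dob dx) ∘ (ev dy ▹ dob dx) ∘ ((dob dy ◃ f) ▹ dob dx) ∘
    assocV (dob dy) x (dob dx) ∘ (dob dy ◃ coev dx) ∘ ruV (dob dy).

Definition dual_unit : dual_data (𝟙 : C) := DualData (lu 𝟙) (luV 𝟙).

Definition dual_tensor (x y : C) (dx : dual_data x) (dy : dual_data y) :
    dual_data (x ⊗ y) :=
  @DualData k C (x ⊗ y) (dob dy ⊗ dob dx)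
    (ev dy ∘ (dob dy ◃ (lu y ∘ (ev dx ▹ y) ∘ assocV (dob dx) x y)) ∘
       assoc (dob dy) (dob dx) (x ⊗ y))
    (assocV x y (dob dy ⊗ dob dx) ∘
       (x ◃ (assoc y (dob dy) (dob dx) ∘ (coev dy ▹ dob dx) ∘ luV (dob dx))) ∘
       coev dx).

End Duals.

(* A left dual [lob x] of [x] makes [x] a right dual of [lob x]. *)
Record rigid (k : fieldType) (C : moncat k) := Rigid {
  rd : forall x : C, dual_data x;
  rdP : forall x, is_dual (rd x);
  lob : C -> C;
  lev : forall x, hom (x ⊗ lob x) 𝟙;
  lcoev : forall x, hom 𝟙 (lob x ⊗ x);
  ldP : forall x, is_dual (DualData (lev x) (lcoev x))
}.

Record ftcat (k : fieldType) := FTCat {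
  ftmon :> moncat k;
  ftrigid :> rigid ftmon;
  ft_fin : is_finite_abelian ftmon;
  ft_unit : bijective (fun a : k => a *: idm (𝟙 : ftmon))
}.

Section Pivotal.
Variables (k : fieldType) (C : ftcat k).

Definition dual (x : C) : C := dob (rd C x).
Definition dual_mor (x y : C) (f : hom x y) : hom (dual y) (dual x) :=
  mate (rd C x) (rd C y) f.

(* [(x ⊗ y)^∨ -> y^∨ ⊗ x^∨] and [𝟙^∨ -> 𝟙] *)
Definition dual2 (x y : C) : hom (dual (x ⊗ y)) (dual y ⊗ dual x) :=
  mate (dual_tensor (rd C x) (rd C y)) (rd C (x ⊗ y)) (idm (x ⊗ y)).
Definition dual0 : hom (dual 𝟙) (𝟙 : C) :=
  mate (dual_unit C) (rd C 𝟙) (idm 𝟙).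

(* The monoidal structure [x^∨∨ ⊗ y^∨∨ -> (x ⊗ y)^∨∨], [𝟙 -> 𝟙^∨∨]. *)
Definition ddual2 (x y : C) :
    hom (dual (dual x) ⊗ dual (dual y)) (dual (dual (x ⊗ y))) :=
  mate (rd C (dual (x ⊗ y)))
       (dual_tensor (rd C (dual y)) (rd C (dual x))) (dual2 x y).
Definition ddual0 : hom 𝟙 (dual (dual (𝟙 : C))) :=
  mate (rd C (dual 𝟙)) (dual_unit C) dual0.

Record pivotal_structure := PivotalStructure {
  piv :> forall x : C, hom x (dual (dual x));
  piv_nat : forall x y (f : hom x y),
    piv y ∘ f = dual_mor (dual_mor f) ∘ piv x;
  piv_iso : forall x, is_iso (piv x);
  piv_tensor : forall x y, piv (x ⊗ y) = ddual2 x y ∘ (piv x ⊗₁ piv y);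
  piv_unit : piv 𝟙 = ddual0
}.

End Pivotal.

Record pftcat (k : fieldType) := PFTCat {
  pft :> ftcat k;
  pivot : pivotal_structure pft
}.

Section PivotalFunctor.
Variables (k : fieldType) (C D : pftcat k) (F : tensor_functor C D).

(* [F (x^∨)] as a dual of [F x] *)
Definition image_dual (x : C) : dual_data (F x) :=
  @DualData k D (F x) (F (dual x))
    (F0V F ∘ fmap F (ev (rd C x)) ∘ F2 F (dual x) x)
    (F2V F x (dual x) ∘ fmap F (coev (rd C x)) ∘ F0 F).

Definition zeta (x : C) : hom (F (dual x)) (dual (F x)) :=
  mate (rd D (F x)) (image_dual x) (idm (F x)).

Definition is_pivotal : Prop :=
  forall x : C,
    dual_mor (zeta x) ∘ pivot D (F x) = zeta (dual x) ∘ fmap F (pivot C x).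

End PivotalFunctor.

Section Frobenius.
Variables (k : fieldType) (C D : moncat k) (F : tensor_functor C D).
Variables (L R : functor D C).
Variables (adjL : adjunction L F) (adjR : adjunction F R).

Definition is_frobenius : Prop :=
  exists t : forall d, hom (L d) (R d), is_natural_iso t.

(* The induced bimodule structures; the oplax maps of [L] and the lax maps of
   [R] are invertible when [C] is rigid, so a natural isomorphism is one of
   bimodule functors when it carries the former to the inverses of the latter,
   as stated in [is_tfrobenius] without inverses. *)
Definition la_lact (c : C) (d : D) : hom (L (F c ⊗ d)) (c ⊗ L d) :=
  transL adjL (F2 F c (L d) ∘ (F c ◃ aunit adjL d)).
Definition la_ract (d : D) (c : C) : hom (L (d ⊗ F c)) (L d ⊗ c) :=
  transL adjL (F2 F (L d) c ∘ (aunit adjL d ▹ F c)).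
Definition ra_lact (c : C) (d : D) : hom (c ⊗ R d) (R (F c ⊗ d)) :=
  transR adjR ((F c ◃ acounit adjR d) ∘ F2V F c (R d)).
Definition ra_ract (d : D) (c : C) : hom (R d ⊗ c) (R (d ⊗ F c)) :=
  transR adjR ((acounit adjR d ▹ F c) ∘ F2V F (R d) c).

Definition is_tfrobenius : Prop :=
  exists t : forall d, hom (L d) (R d),
    [/\ is_natural_iso t,
        forall c d, ra_lact c d ∘ (c ◃ t d) ∘ la_lact c d = t (F c ⊗ d)
      & forall d c, ra_ract d c ∘ (t d ▹ c) ∘ la_ract d c = t (d ⊗ F c)].

End Frobenius.

Record algebra (k : fieldType) (C : moncat k) := Algebra {
  acar :> C;
  amul : hom (acar ⊗ acar) acar;
  aone : hom 𝟙 acar;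
  amulA : amul ∘ (amul ▹ acar) = amul ∘ (acar ◃ amul) ∘ assoc acar acar acar;
  amul1m : amul ∘ (aone ▹ acar) = lu acar;
  amulm1 : amul ∘ (acar ◃ aone) = ru acar
}.
Arguments amul {k C} A : rename.
Arguments aone {k C} A : rename.

Section Algebras.
Variables (k : fieldType).

Definition unit_algebra (C : moncat k) : algebra C.
Proof.
refine (@Algebra k C 𝟙 (lu 𝟙) (idm 𝟙) _ _ _).
- by rewrite -compA triangle lu_unit.
- by rewrite tmor1 compm1.
- by rewrite tmor1 compm1 lu_unit.
Defined.

Definition lax_algebra (C D : moncat k) (G : laxmon C D) (A : algebra C) :
  algebra D.
Proof.
refine (@Algebra k D (G A) (fmap G (amul A) ∘ F2 G A A)
  (fmap G (aone A) ∘ F0 G) _ _ _).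
- rewrite wrM wlM -!compA.
  have h := F2_nat G (amul A) (idm A); rewrite fmap1 in h.
  have h' := F2_nat G (idm A) (amul A); rewrite fmap1 in h'.
  rewrite (compA (F2 G _ _)) h (compA (F2 G _ _) (_ ◃ fmap _ _)) h' !compA.
  by rewrite -!fmapM amulA fmapM -!compA (compA (fmap G (assoc _ _ _))) F2_assoc !compA.
- have h := F2_nat G (aone A) (idm A); rewrite fmap1 in h.
  by rewrite wrM -!compA (compA (F2 G _ _)) h !compA -!fmapM amul1m F2_lu.
- have h := F2_nat G (idm A) (aone A); rewrite fmap1 in h.
  by rewrite wlM -!compA (compA (F2 G _ _)) h !compA -!fmapM amulm1 F2_ru.
Defined.

Record frobenius_structure (C : moncat k) (A : algebra C) := FrobeniusStructure {
  cmul : hom A (A ⊗ A);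
  cone : hom A 𝟙;
  cmulA : assoc A A A ∘ (cmul ▹ A) ∘ cmul = (A ◃ cmul) ∘ cmul;
  cmul1m : (cone ▹ A) ∘ cmul = luV A;
  cmulm1 : (A ◃ cone) ∘ cmul = ruV A;
  frobl : (amul A ▹ A) ∘ assocV A A A ∘ (A ◃ cmul) = cmul ∘ amul A;
  frobr : (A ◃ amul A) ∘ assoc A A A ∘ (cmul ▹ A) = cmul ∘ amul A
}.
Arguments cone {C A} f : rename.

(* The canonical [(^∨x)^∨∨ -> x^∨], as [x] is a right dual of [^∨x] *)
Definition dual_lob (C : ftcat k) (x : C) : hom (dual (dual (lob C x))) (dual x) :=
  dual_mor (mate (rd C (lob C x)) (DualData (lev C x) (lcoev C x)) (idm (lob C x))).

Definition is_symmetric (C : pftcat k) (A : algebra C)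
    (fr : frobenius_structure A) : Prop :=
  lu (dual A) ∘ ((cone fr ∘ amul A) ▹ dual A) ∘ assocV A A (dual A) ∘
    (A ◃ coev (rd C A)) ∘ ruV A =
  dual_lob A ∘ ru _ ∘ (pivot C (lob C A) ⊗₁ (cone fr ∘ amul A)) ∘
    assoc (lob C A) A A ∘ (lcoev C A ▹ A) ∘ luV A.

Definition has_symmetric_frobenius (C : pftcat k) (A : algebra C) : Prop :=
  exists fr : frobenius_structure A, is_symmetric fr.

Definition is_haploid (C : moncat k) (A : algebra C) : Prop :=
  \dim {: hom 𝟙 A} = 1%N.

Record braiding (C : moncat k) := Braiding {
  br :> forall x y : C, hom (x ⊗ y) (y ⊗ x);
  br_iso : forall x y, is_iso (br x y);
  br_nat : forall x y x' y' (f : hom x y) (f' : hom x' y'),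
    br y y' ∘ (f ⊗₁ f') = (f' ⊗₁ f) ∘ br x x';
  br_hexl : forall x y z,
    assoc y z x ∘ br x (y ⊗ z) ∘ assoc x y z =
    (y ◃ br x z) ∘ assoc y x z ∘ (br x y ▹ z);
  br_hexr : forall x y z,
    assocV z x y ∘ br (x ⊗ y) z ∘ assocV x y z =
    (br x z ▹ y) ∘ assocV x z y ∘ (x ◃ br y z)
}.

Definition is_commutative (C : moncat k) (b : braiding C) (A : algebra C) : Prop :=
  amul A ∘ b A A = amul A.

Definition is_braided (C D : moncat k) (b : braiding C) (b' : braiding D)
    (F : laxmon C D) : Prop :=
  forall x y, fmap F (b x y) ∘ F2 F x y = F2 F y x ∘ b' (F x) (F y).

End Algebras.

Section Subspaces.
Variables (k : fieldType) (V : vectType k).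

Definition lin_closed (P : V -> Prop) : Prop :=
  P 0 /\ forall (a : k) u v, P u -> P v -> P (a *: u + v).

Lemma lin_subspace (P : V -> Prop) :
  lin_closed P -> exists U : {vspace V}, forall v, v \in U <-> P v.
Proof.
move=> [P0 PD].
have step (U : {vspace V}) : (forall v, v \in U -> P v) ->
    exists U' : {vspace V}, forall v, v \in U' <-> P v.
  have [n] := ubnP (\dim {:V} - \dim U)%N.
  elim: n U => // n IH U ltUn UP.
  have [[v [Pv vU]]|noV] := pselect (exists v, P v /\ v \notin U); last first.
    exists U => v; split=> [|Pv]; first exact: UP.
    by apply: contrapT => /negP vU; apply: noV; exists v.
  apply: (IH (<[v]> + U)%VS); last first.
    by move=> w /memv_addP[_ /vlineP[a ->] [u uU ->]]; apply: PD => //; exact: UP.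
  have lt : (\dim U < \dim (<[v]> + U))%N.
    rewrite ltn_neqAle dimvS ?addvSr // andbT; apply: contra vU => /eqP E.
    have /eqP -> : (U == <[v]> + U)%VS by rewrite eqEdim addvSr E leqnn.
    by apply: (subvP (addvSl _ _)); exact: memv_line.
  have le : (\dim (<[v]> + U)%VS <= \dim {:V})%N by rewrite dimvS ?subvf.
  apply: leq_trans (_ : (\dim {:V} - \dim U <= n)%N); last by rewrite -ltnS.
  by apply: ltn_sub2l => //; exact: leq_trans lt le.
by apply: (step 0%VS) => v; rewrite memv0 => /eqP->.
Qed.

Lemma lin_closed_eq (W : lmodType k) (f g : V -> W) :
  linear f -> linear g -> lin_closed (fun v => f v = g v).
Proof.
have lin0 (h : V -> W) : linear h -> h 0 = 0.
  by move=> hl; have := hl (-1) 0 0; rewrite scaler0 addr0 scaleN1r addNr.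
move=> fl gl; split=> [|a u v Eu Ev]; first by rewrite !lin0.
by rewrite fl gl Eu Ev.
Qed.

Definition vsub (P : V -> Prop) (h : lin_closed P) : {vspace V} :=
  sval (cid (lin_subspace h)).

Lemma vsubP (P : V -> Prop) (h : lin_closed P) v : v \in vsub h <-> P v.
Proof. by rewrite /vsub; case: cid. Qed.

End Subspaces.

(* Objects of [C] with extra structure; the morphisms [X -> Y] are those
   morphisms of [C] between the underlying objects that satisfy [sok X Y]. *)
Record structured (k : fieldType) (C : lincat k) := Structured {
  sob :> Type;
  und : sob -> C;
  sok : forall X Y : sob, hom (und X) (und Y) -> Prop;
  sok_lin : forall X Y, lin_closed (@sok X Y);
  sok_id : forall X, sok (idm (und X));
  sok_comp : forall (X Y Z : sob) (g : hom (und Y) (und Z)) (f : hom (und X) (und Y)),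
    sok g -> sok f -> sok (g ∘ f)
}.
Arguments und {k C s} X : rename.
Arguments sok {k C s X Y} f : rename.

Section StructuredCat.
Variables (k : fieldType) (C : lincat k) (S : structured C).
Implicit Types X Y Z : S.

Definition shom X Y : vectType k := subvs_of (vsub (sok_lin X Y)).
Definition smor X Y (f : shom X Y) : hom (und X) (und Y) := vsval f.
Definition sMk X Y (f : hom (und X) (und Y)) (h : sok f) : shom X Y :=
  Subvs (proj2 (vsubP (sok_lin X Y) f) h).

Lemma smorK X Y (f : hom (und X) (und Y)) (h : sok f) : smor (sMk h) = f.
Proof. by []. Qed.
Lemma smorP X Y (f : shom X Y) : sok (smor f).
Proof. exact: (proj1 (vsubP (sok_lin X Y) _) (subvsP f)). Qed.
Lemma smor_inj X Y : injective (@smor X Y). Proof. exact: val_inj. Qed.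
Lemma smor_lin X Y : linear (@smor X Y). Proof. by move=> a u v; rewrite /smor linearP. Qed.

Definition structured_cat : lincat k.
Proof.
refine (@LinCat k S shom (fun X => sMk (sok_id X))
  (fun X Y Z g f => sMk (sok_comp (smorP g) (smorP f))) _ _ _ _ _).
- by move=> *; apply: smor_inj; rewrite !smorK compA.
- by move=> *; apply: smor_inj; rewrite !smorK comp1m.
- by move=> *; apply: smor_inj; rewrite !smorK compm1.
- by move=> X Y Z f a g h; apply: smor_inj; rewrite [RHS]smor_lin !smorK smor_lin comp_linl.
- by move=> X Y Z f a g h; apply: smor_inj; rewrite [RHS]smor_lin !smorK smor_lin comp_linr.
Defined.

Lemma smorM (X Y Z : structured_cat) (g : hom Y Z) (f : hom X Y) :
  smor (g ∘ f) = smor g ∘ smor f.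
Proof. by []. Qed.
Lemma smor1 (X : structured_cat) : smor (idm X) = idm (und (X : S)).
Proof. by []. Qed.

Definition und_functor : functor structured_cat C.
Proof.
refine (@Functor k structured_cat C und smor _ _ _) => //.
Defined.

End StructuredCat.

Record modcat (k : fieldType) (C : moncat k) := ModCat {
  mdcat :> lincat k;
  aobj : C -> mdcat -> mdcat;
  amor : forall (x y : C) (m n : mdcat),
    hom x y -> hom m n -> hom (aobj x m) (aobj y n);
  amor1 : forall x m, amor (idm x) (idm m) = idm (aobj x m);
  amorM : forall (x y z : C) (m n p : mdcat) (g : hom y z) (f : hom x y)
      (g' : hom n p) (f' : hom m n),
    amor (g ∘ f) (g' ∘ f') = amor g g' ∘ amor f f';
  amor_linl : forall x y m n (f' : hom m n),
    linear (fun f : hom x y => amor f f');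
  amor_linr : forall (x y : C) m n (f : hom x y),
    linear (fun f' : hom m n => amor f f');
  massoc : forall x y m, hom (aobj (x ⊗ y) m) (aobj x (aobj y m));
  mlu : forall m, hom (aobj 𝟙 m) m;
  massoc_iso : forall x y m, is_iso (massoc x y m);
  mlu_iso : forall m, is_iso (mlu m);
  massoc_nat : forall (x y x' y' : C) (m n : mdcat)
      (f : hom x y) (f' : hom x' y') (g : hom m n),
    massoc y y' n ∘ amor (f ⊗₁ f') g = amor f (amor f' g) ∘ massoc x x' m;
  mlu_nat : forall m n (g : hom m n), mlu n ∘ amor (idm 𝟙) g = g ∘ mlu m;
  mpentagon : forall x y z m,
    massoc x y (aobj z m) ∘ massoc (x ⊗ y) z m =
    amor (idm x) (massoc y z m) ∘ massoc x (y ⊗ z) m ∘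
      amor (assoc x y z) (idm m);
  mtriangle : forall x m,
    amor (idm x) (mlu m) ∘ massoc x 𝟙 m = amor (ru x) (idm m)
}.
Arguments aobj {k C m} x n : rename.

Definition is_exact_modcat (k : fieldType) (C : moncat k) (M : modcat C) : Prop :=
  forall (p : C) (m : M), is_projective p -> is_projective (aobj p m).

Section RightModules.
Variables (k : fieldType) (C : moncat k) (A : algebra C).

Record rmodule := RModule {
  rmcar :> C;
  ract : hom (rmcar ⊗ A) rmcar;
  ractA : ract ∘ (ract ▹ A) = ract ∘ (rmcar ◃ amul A) ∘ assoc rmcar A A;
  ract1 : ract ∘ (rmcar ◃ aone A) = ru rmcar
}.

Definition is_rmod_mor (M N : rmodule) (f : hom M N) : Prop :=
  f ∘ ract M = ract N ∘ (f ▹ A).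

Definition rmod_structured : structured C.
Proof.
refine (@Structured k C rmodule rmcar is_rmod_mor _ _ _).
- move=> M N; apply: lin_closed_eq; first exact: comp_linl.
  by move=> a f g; rewrite tmor_linl comp_linr.
- by move=> M; rewrite /is_rmod_mor tmor1 comp1m compm1.
- by move=> M N P g f Eg Ef; rewrite /is_rmod_mor wrM -compA Ef !compA Eg.
Defined.

End RightModules.

Section RightModuleCategory.
Variables (k : fieldType) (C : moncat k) (A : algebra C).
Local Notation S := (rmod_structured A).

Lemma is_rmod_mor_inv (M N : rmodule A) (f : hom M N) (g : hom N M) :
  is_inverse f g -> is_rmod_mor f -> is_rmod_mor g.
Proof.
move=> [gf fg] Ef; rewrite /is_rmod_mor.
have fi : is_iso f by exists g.
apply: (iso_mono fi); apply: (iso_epi (is_iso_tmor fi (is_iso_id A))).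
rewrite compA fg comp1m -!compA -wrM gf tmor1 compm1; exact/esym.
Qed.

Lemma rmod_iso (M N : structured_cat S) (f : hom M N) : is_iso (smor f) -> is_iso f.
Proof.
case=> g inv; have h : sok (s := S) g := is_rmod_mor_inv inv (smorP f).
by exists (sMk h); case: inv => gf fg; split; apply: smor_inj.
Qed.

Definition act_rmodule (x : C) (M : rmodule A) : rmodule A.
Proof.
refine (@RModule k C A (x ⊗ M) ((x ◃ ract M) ∘ assoc x M A) _ _).
- rewrite wrM -!compA (compA (assoc x M A) ((x ◃ _) ▹ _)) assoc_nat.
  rewrite -tmor1 (compA (assoc x M A) ((_ ⊗₁ _) ⊗₁ _)) assoc_nat -!compA.
  rewrite -[assoc (x ⊗ M) A A]compm1 pentagonA !compm1 !compA -!wlM.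
  by rewrite ractA.
- by rewrite -tmor1 -compA assoc_nat compA -wlM ract1 ruA.
Defined.

Lemma act_rmod_mor (x y : C) (M N : rmodule A) (f : hom x y) (g : hom M N) :
  is_rmod_mor g ->
  @is_rmod_mor k C A (act_rmodule x M) (act_rmodule y N) (f ⊗₁ g).
Proof.
rewrite /is_rmod_mor /= => E.
by rewrite -compA assoc_nat !compA -!tmorM comp1m compm1 E.
Qed.

Lemma assoc_rmod_mor (x y : C) (M : rmodule A) :
  @is_rmod_mor k C A (act_rmodule (x ⊗ y) M)
    (act_rmodule x (act_rmodule y M)) (assoc x y M).
Proof.
rewrite /is_rmod_mor /= wlM compA -tmor1 assoc_nat -!compA; congr (_ ∘ _).
by rewrite pentagon -!compA.
Qed.

Lemma lu_rmod_mor (M : rmodule A) :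
  @is_rmod_mor k C A (act_rmodule 𝟙 M) M (lu M).
Proof. by rewrite /is_rmod_mor /= compA lu_nat -compA luA. Qed.

Definition rmod_cat : modcat C.
Proof.
refine (@ModCat k C (structured_cat S) act_rmodule
  (fun x y M N f g => sMk (act_rmod_mor f (smorP g) : sok (s := S) _))
  _ _ _ _
  (fun x y M => sMk (assoc_rmod_mor x y M : sok (s := S) _))
  (fun M => sMk (lu_rmod_mor M : sok (s := S) _)) _ _ _ _ _ _).
- by move=> *; apply: smor_inj; rewrite !smorK /= tmor1.
- by move=> *; apply: smor_inj; rewrite !smorK /= tmorM.
- by move=> x y M N f' a f g; apply: smor_inj; rewrite [RHS]smor_lin !smorK tmor_linl.
- by move=> x y M N f a g h; apply: smor_inj;
    rewrite [RHS]smor_lin !smorK smor_lin tmor_linr.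
- by move=> x y M; apply: rmod_iso; exact: is_iso_assoc.
- by move=> M; apply: rmod_iso; exact: is_iso_lu.
- by move=> *; apply: smor_inj; rewrite !smorM !smorK assoc_nat.
- by move=> *; apply: smor_inj; rewrite !smorM !smorK lu_nat.
- by move=> *; apply: smor_inj; rewrite !smorM !smorK pentagon.
- by move=> *; apply: smor_inj; rewrite !smorM !smorK triangle.
Defined.

Definition is_exact_algebra : Prop := is_exact_modcat rmod_cat.

End RightModuleCategory.

Section PentagonVariants.
Variables (k : fieldType) (C : moncat k).
Implicit Types x y z w v : C.

Lemma assocKA v x y z (h : hom v (x ⊗ y ⊗ z)) : assocV x y z ∘ (assoc x y z ∘ h) = h.
Proof. by rewrite compA assocK comp1m. Qed.
Lemma assocVKA v x y z (h : hom v (x ⊗ (y ⊗ z))) : assoc x y z ∘ (assocV x y z ∘ h) = h.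
Proof. by rewrite compA assocVK comp1m. Qed.
Lemma assocKl v x y z w (h : hom v (w ⊗ (x ⊗ y ⊗ z))) :
  (w ◃ assocV x y z) ∘ ((w ◃ assoc x y z) ∘ h) = h.
Proof. by rewrite compA -wlM assocK tmor1 comp1m. Qed.
Lemma assocVKl v x y z w (h : hom v (w ⊗ (x ⊗ (y ⊗ z)))) :
  (w ◃ assoc x y z) ∘ ((w ◃ assocV x y z) ∘ h) = h.
Proof. by rewrite compA -wlM assocVK tmor1 comp1m. Qed.
Lemma assocKr v x y z w (h : hom v (x ⊗ y ⊗ z ⊗ w)) :
  (assocV x y z ▹ w) ∘ ((assoc x y z ▹ w) ∘ h) = h.
Proof. by rewrite compA -wrM assocK tmor1 comp1m. Qed.
Lemma assocVKr v x y z w (h : hom v (x ⊗ (y ⊗ z) ⊗ w)) :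
  (assoc x y z ▹ w) ∘ ((assocV x y z ▹ w) ∘ h) = h.
Proof. by rewrite compA -wrM assocVK tmor1 comp1m. Qed.

Lemma pentagonB v x y z w (h : hom v (x ⊗ (y ⊗ (z ⊗ w)))) :
  (assocV x y z ▹ w) ∘ (assocV x (y ⊗ z) w ∘ ((x ◃ assocV y z w) ∘ h)) =
  assocV (x ⊗ y) z w ∘ (assocV x y (z ⊗ w) ∘ h).
Proof.
rewrite -[in LHS](assocVKA h) -[in LHS](assocVKA (assocV x y (z ⊗ w) ∘ h)).
by rewrite pentagonA assocKl assocKA assocKr.
Qed.

Lemma pentagonC v x y z w (h : hom v (x ⊗ (y ⊗ z) ⊗ w)) :
  assocV x y (z ⊗ w) ∘ ((x ◃ assoc y z w) ∘ (assoc x (y ⊗ z) w ∘ h)) =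
  assoc (x ⊗ y) z w ∘ ((assocV x y z ▹ w) ∘ h).
Proof. by rewrite -[in LHS](assocVKr h) -pentagonA assocKA. Qed.

Lemma pentagonD v x y z w (h : hom v (x ⊗ y ⊗ (z ⊗ w))) :
  assoc x (y ⊗ z) w ∘ ((assoc x y z ▹ w) ∘ (assocV (x ⊗ y) z w ∘ h)) =
  (x ◃ assocV y z w) ∘ (assoc x y (z ⊗ w) ∘ h).
Proof. by rewrite -[in RHS](assocVKA h) pentagonA assocKl. Qed.

Lemma assoc_natA v x y x' y' x'' y'' (f : hom x y) (f' : hom x' y')
    (f'' : hom x'' y'') (h : hom v (x ⊗ x' ⊗ x'')) :
  assoc y y' y'' ∘ ((f ⊗₁ f' ⊗₁ f'') ∘ h) =
  (f ⊗₁ (f' ⊗₁ f'')) ∘ (assoc x x' x'' ∘ h).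
Proof. by rewrite compA assoc_nat -compA. Qed.

Lemma assocV_natA v x y x' y' x'' y'' (f : hom x y) (f' : hom x' y')
    (f'' : hom x'' y'') (h : hom v (x ⊗ (x' ⊗ x''))) :
  assocV y y' y'' ∘ ((f ⊗₁ (f' ⊗₁ f'')) ∘ h) =
  (f ⊗₁ f' ⊗₁ f'') ∘ (assocV x x' x'' ∘ h).
Proof. by rewrite -[in LHS](assocVKA h) -assoc_natA assocKA. Qed.

Lemma exchA v x y x' y' (f : hom x y) (f' : hom x' y') (h : hom v (x ⊗ x')) :
  (f ▹ y') ∘ ((x ◃ f') ∘ h) = (y ◃ f') ∘ ((f ▹ x') ∘ h).
Proof. by rewrite !compA exch. Qed.

End PentagonVariants.

Section Center.
Variables (k : fieldType) (C : moncat k).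

(* Half-braidings [x ⊗ - -> - ⊗ x]. *)
Record half_braided := HalfBraided {
  hbcar :> C;
  hb : forall y, hom (hbcar ⊗ y) (y ⊗ hbcar);
  hb_iso : forall y, is_iso (hb y);
  hb_nat : forall y z (f : hom y z), hb z ∘ (hbcar ◃ f) = (f ▹ hbcar) ∘ hb y;
  hb_tensor : forall y z,
    assoc y z hbcar ∘ hb (y ⊗ z) ∘ assoc hbcar y z =
    (y ◃ hb z) ∘ assoc y hbcar z ∘ (hb y ▹ z)
}.

Definition is_center_mor (X Y : half_braided) (f : hom X Y) : Prop :=
  forall y, (y ◃ f) ∘ hb X y = hb Y y ∘ (f ▹ y).

Definition center_structured : structured C.
Proof.
refine (@Structured k C half_braided hbcar is_center_mor _ _ _).
- move=> X Y.
  have h y : lin_closed (fun f : hom X Y => (y ◃ f) ∘ hb X y = hb Y y ∘ (f ▹ y)).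
    apply: lin_closed_eq => a f g; first by rewrite tmor_linr comp_linl.
    by rewrite tmor_linl comp_linr.
  split=> [y|a f g Ef Eg y]; first by case: (h y).
  by case: (h y) => _; apply.
- by move=> X y; rewrite !tmor1 comp1m compm1.
- by move=> X Y Z g f Eg Ef y; rewrite wlM wrM -compA Ef !compA Eg.
Defined.
Local Notation S := center_structured.
Local Notation Z := (structured_cat S).

Lemma is_center_mor_inv (X Y : half_braided) (f : hom X Y) (g : hom Y X) :
  is_inverse f g -> is_center_mor f -> is_center_mor g.
Proof.
move=> [gf fg] Ef y; have fi : is_iso f by exists g.
apply: (iso_mono (is_iso_tmor (is_iso_id y) fi)).
apply: (iso_epi (is_iso_tmor fi (is_iso_id y))).
rewrite compA -wlM fg tmor1 comp1m -!compA -wrM gf tmor1 compm1; exact/esym.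
Qed.

Lemma center_iso (X Y : Z) (f : hom X Y) : is_iso (smor f) -> is_iso f.
Proof.
case=> g inv; have h : sok (s := S) g := is_center_mor_inv inv (smorP f).
by exists (sMk h); case: inv => gf fg; split; apply: smor_inj.
Qed.

Lemma hb_natA (X : half_braided) v y z (f : hom y z) (h : hom v (X ⊗ y)) :
  hb X z ∘ ((X ◃ f) ∘ h) = (f ▹ X) ∘ (hb X y ∘ h).
Proof. by rewrite compA hb_nat -compA. Qed.

Lemma hb_tensorE (X : half_braided) y z : hb X (y ⊗ z) =
  assocV y z X ∘ ((y ◃ hb X z) ∘ (assoc y X z ∘ ((hb X y ▹ z) ∘ assocV X y z))).
Proof.
apply: (iso_mono (is_iso_assoc y z X)); rewrite assocVKA.
apply: (iso_epi (is_iso_assoc X y z)); rewrite hb_tensor -!compA assocK compm1 //.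
Qed.

Definition hbT (X Y : half_braided) (y : C) : hom (X ⊗ Y ⊗ y) (y ⊗ (X ⊗ Y)) :=
  assoc y X Y ∘ ((hb X y ▹ Y) ∘ (assocV X y Y ∘ ((X ◃ hb Y y) ∘ assoc X Y y))).

Definition center_tensor (X Y : half_braided) : half_braided.
Proof.
refine (@HalfBraided (X ⊗ Y) (hbT X Y) _ _ _).
- move=> y; apply: is_iso_comp (is_iso_assoc _ _ _) _.
  apply: is_iso_comp (is_iso_tmor (hb_iso X y) (is_iso_id _)) _.
  apply: is_iso_comp (is_iso_assocV _ _ _) _.
  apply: is_iso_comp (is_iso_tmor (is_iso_id _) (hb_iso Y y)) _.
  exact: is_iso_assoc.
- move=> y z f; rewrite /hbT -!compA -tmor1 assoc_nat.
  rewrite (compA (X ◃ hb Y z)) -wlM hb_nat wlM -!compA assocV_natA.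
  by rewrite (compA (hb X z ▹ Y)) -wrM hb_nat wrM -!compA assoc_natA tmor1.
- move=> y z; rewrite /hbT !hb_tensorE !wlM !wrM -!compA.
  rewrite pentagonA assocVKr.
  rewrite -[assoc (X ⊗ Y) y z]compm1 pentagonA compm1 assocKl.
  rewrite assoc_natA; do 2!congr (_ ∘ _).
  rewrite -(assoc_natA (idm X) (hb Y y) (idm z)).
  rewrite pentagonB assocV_natA tmor1 pentagonC -assocV_natA tmor1 exchA pentagonD.
  rewrite -tmor1 assoc_natA; do 2!congr (_ ∘ _).
  rewrite -tmor1 -assoc_natA pentagonA //.
Defined.



Definition center_unit : half_braided.
Proof.
refine (@HalfBraided 𝟙 (fun y => ruV y ∘ lu y) _ _ _).
- by move=> y; apply: is_iso_comp (is_iso_ruV y) (is_iso_lu y).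
- move=> y z f; rewrite -compA lu_nat.
  apply: (iso_mono (is_iso_ru z)); rewrite !compA ruVK comp1m ru_nat.
  by rewrite -(compA f) ruVK compm1.
- move=> y z; rewrite wlM wrM -!compA luA.
  rewrite (compA (y ◃ lu z)) triangle (compA (ru y ▹ z)) -wrM ruVK tmor1 comp1m.
  rewrite compA; congr (_ ∘ _).
  apply: (iso_mono (is_iso_tmor (is_iso_id y) (is_iso_ru z))).
  by rewrite compA ruA ruVK -wlM ruVK tmor1.
Defined.

Lemma tmor_center_mor (X X' Y Y' : half_braided) (f : hom X X') (g : hom Y Y') :
  is_center_mor f -> is_center_mor g ->
  @is_center_mor (center_tensor X Y) (center_tensor X' Y') (f ⊗₁ g).
Proof.
move=> Ef Eg y; rewrite /= /hbT -!compA assoc_nat.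
rewrite -assoc_natA; congr (_ ∘ _).
rewrite (compA ((y ◃ f) ⊗₁ g)) -tmorM Ef compm1.
rewrite (compA (X' ◃ hb Y' y)) -tmorM -Eg comp1m.
rewrite -[g in LHS]comp1m tmorM -!compA; congr (_ ∘ _).
by rewrite -[f in RHS]compm1 tmorM -compA assocV_natA.
Qed.

Lemma assoc_center_mor (X Y Z : half_braided) :
  @is_center_mor (center_tensor (center_tensor X Y) Z)
    (center_tensor X (center_tensor Y Z)) (assoc X Y Z).
Proof.
move=> y; rewrite /= /hbT !wlM !wrM -!compA.
rewrite -pentagonA -[(hb X y ▹ Y) ▹ Z]/((hb X y ⊗₁ idm Y) ⊗₁ idm Z) assoc_natA tmor1.
do 2!congr (_ ∘ _); rewrite -pentagonC assoc_natA pentagonD.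
do 4!congr (_ ∘ _).
have E := assoc_natA (idm X) (idm Y) (hb Z y) (assoc (X ⊗ Y) Z y).
rewrite tmor1 in E; apply: (etrans E); congr (_ ∘ _).
exact: etrans (pentagon _ _ _ _) (esym (compA _ _ _)).
Qed.

Lemma lu_center_mor (X : half_braided) :
  @is_center_mor (center_tensor center_unit X) X (lu X).
Proof.
move=> y; rewrite /= /hbT wrM -!compA (compA (y ◃ lu X)) triangle.
rewrite (compA (ru y ▹ X)) -wrM ruVK tmor1 comp1m.
rewrite -(luA y X) -compA assocVKA.
by rewrite compA lu_nat -compA luA.
Qed.

Lemma ru_center_mor (X : half_braided) :
  @is_center_mor (center_tensor X center_unit) X (ru X).
Proof.
move=> y; rewrite /= /hbT wlM -!compA (compA (y ◃ ru X)) ruA.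
rewrite (compA (ru _)) ru_nat -!compA -ruA -!compA assocVKA.
by rewrite (compA (X ◃ ru y)) -wlM ruVK tmor1 comp1m triangle.
Qed.

Definition center : moncat k.
Proof.
refine (@MonCat k Z center_tensor
  (fun X Y X' Y' f f' => sMk (tmor_center_mor (smorP f) (smorP f') : sok (s := S) _))
  center_unit _ _ _ _
  (fun X Y Z => sMk (assoc_center_mor X Y Z : sok (s := S) _))
  (fun X Y Z => sMk (@is_center_mor_inv (center_tensor (center_tensor X Y) Z)
     (center_tensor X (center_tensor Y Z)) _ _ (assocP X Y Z)
     (@assoc_center_mor X Y Z) : sok (s := S) _))
  (fun X => sMk (lu_center_mor X : sok (s := S) _))
  (fun X => sMk (@is_center_mor_inv (center_tensor center_unit X) X _ _ (luP X)
     (@lu_center_mor X) : sok (s := S) _))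
  (fun X => sMk (ru_center_mor X : sok (s := S) _))
  (fun X => sMk (@is_center_mor_inv (center_tensor X center_unit) X _ _ (ruP X)
     (@ru_center_mor X) : sok (s := S) _))
  _ _ _ _ _ _ _ _).
- by move=> *; apply: smor_inj; rewrite !smorK /= tmor1.
- by move=> *; apply: smor_inj; rewrite !smorK /= tmorM.
- by move=> X Y X' Y' f' a f g; apply: smor_inj;
    rewrite [RHS]smor_lin !smorK smor_lin tmor_linl.
- by move=> X Y X' Y' f' a f g; apply: smor_inj;
    rewrite [RHS]smor_lin !smorK smor_lin tmor_linr.
- by move=> X Y Z; split; apply: smor_inj; rewrite smorM !smorK ?assocK ?assocVK.
- by move=> X; split; apply: smor_inj; rewrite smorM !smorK ?luK ?luVK.
- by move=> X; split; apply: smor_inj; rewrite smorM !smorK ?ruK ?ruVK.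
- by move=> *; apply: smor_inj; rewrite !smorM !smorK assoc_nat.
- by move=> *; apply: smor_inj; rewrite !smorM !smorK lu_nat.
- by move=> *; apply: smor_inj; rewrite !smorM !smorK ru_nat.
- by move=> *; apply: smor_inj; rewrite !smorM !smorK pentagon.
- by move=> *; apply: smor_inj; rewrite !smorM !smorK triangle.
Defined.

Lemma hb_center_mor (X Y : half_braided) :
  @is_center_mor (center_tensor X Y) (center_tensor Y X) (hb X Y).
Proof.
move=> y; rewrite /= /hbT -!compA.
have E := hb_tensor X y Y; have E' := esym (hb_tensor X Y y).
rewrite (compA (y ◃ hb X Y)) (compA (_ ∘ _)) -E -!compA assocVKA.
rewrite (compA (hb X (y ⊗ Y))) hb_nat -!compA; do 2!congr (_ ∘ _).
by rewrite (compA (Y ◃ _)) E' -!compA assocKA.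
Qed.

Lemma hb_center_nat (X Y X' Y' : half_braided) (f : hom X Y) (f' : hom X' Y') :
  is_center_mor f -> hb Y Y' ∘ (f ⊗₁ f') = (f' ⊗₁ f) ∘ hb X X'.
Proof.
move=> Ef; rewrite [in LHS]tmorE compA -Ef -compA hb_nat compA -tmorM.
by rewrite comp1m compm1.
Qed.

Lemma hbT_hexr (X Y : half_braided) (z : C) :
  assocV z X Y ∘ hbT X Y z ∘ assocV X Y z =
  (hb X z ▹ Y) ∘ assocV X z Y ∘ (X ◃ hb Y z).
Proof. by rewrite /hbT -!compA assocVK compm1 assocKA. Qed.

Definition center_braiding : braiding center.
Proof.
refine (@Braiding k center
  (fun X Y => sMk (hb_center_mor X Y : sok (s := S) _)) _ _ _ _).
- by move=> X Y; apply: center_iso; exact: hb_iso.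
- move=> X Y X' Y' f f'; apply: smor_inj.
  exact: (hb_center_nat (smor f') (smorP f)).
- move=> X Y Y'; apply: smor_inj; exact: (hb_tensor X Y Y').
- move=> X Y Y'; apply: smor_inj; exact: (hbT_hexr X Y Y').
Defined.

Definition center_forget : laxmon center C.
Proof.
refine (@LaxMon k center C (und_functor S)
  (fun X Y => idm _) (idm _) _ _ _ _) => /=.
- by move=> *; rewrite compm1 comp1m.
- by move=> *; rewrite !tmor1 !compm1 !comp1m.
- by move=> *; rewrite tmor1 !compm1.
- by move=> *; rewrite tmor1 !compm1.
Defined.

End Center.

Record central_structure (k : fieldType) (C D : moncat k) (b : braiding C)
    (F : laxmon C D) := CentralStructure {
  lift :> tensor_functor C (center D);
  lift_braided : is_braided b (center_braiding D) lift;
  lift_cmp : forall c, hom (F c) (center_forget D (lift c));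
  lift_cmp_iso : is_monoidal_iso (G := laxcomp (center_forget D) lift) lift_cmp
}.

(* Main.v *)
(* A Frobenius [F] makes [R = F^ra] also a left adjoint of [F].

   Symmetric Frobenius structure: if the counit [Λ_c : R F c -> c] of [R ⊣ F] is linear
   for both actions of [C], then [f : F c -> F c'] has a partial trace
   [Λ_c' ∘ R f ∘ η_c : c -> c'] compatible with tensoring on either side. Tracing an
   evaluation [x ⊗ y -> 𝟙] and a coevaluation yields a duality between [R x] and [R y],
   and since [F] is pivotal the trace commutes with rotation of pairings; so a symmetric
   nondegenerate form on [A] gives one on [R A]. Linearity of [Λ] holds for a
   ⊗-Frobenius functor. For a Frobenius central functor, [Λ_𝟙] determines a left linear
   [Λ'], again the counit of an adjunction by rigidity, and the braiding makes [Λ'] right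
   linear.

   Exactness: [F] preserves projectives since [R] is exact. Put [B = R A]; a [B]-module
   [N] is a retract of [R Q] for the [A]-module [Q = F N ⊗_{F B} A]. For [p] projective,
   [F p ⊗ Q] is projective, so [F p ⊗ F N ⊗ A -> F p ⊗ Q] splits, and applying [R]
   shows that [p ⊗ N] is a retract of the free module [p ⊗ N ⊗ B]. *)

From mathcomp Require Import all_boot all_algebra boolp.
Require Import Defs.

Set Implicit Arguments.
Unset Strict Implicit.
Unset Printing Implicit Defensive.

Import GRing.Theory.
Local Open Scope ring_scope.

(** * Linear categories and adjunctions *)

Section LinearComposition.
Variables (k : fieldType) (C : lincat k).
Implicit Types x y z w v : C.

Lemma compBl x y z (f : hom x y) (g h : hom y z) : (g - h) ∘ f = g ∘ f - h ∘ f.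
Proof. by rewrite addrC -scaleN1r comp_linl scaleN1r addrC. Qed.

Lemma compBr x y z (g : hom y z) (f h : hom x y) : g ∘ (f - h) = g ∘ f - g ∘ h.
Proof. by rewrite addrC -scaleN1r comp_linr scaleN1r addrC. Qed.

Lemma comp0l x y z (f : hom x y) : (0 : hom y z) ∘ f = 0.
Proof. by rewrite -[0](subrr (0 : hom y z)) compBl subrr. Qed.

Lemma comp0r x y z (g : hom y z) : g ∘ (0 : hom x y) = 0.
Proof. by rewrite -[0](subrr (0 : hom x y)) compBr subrr. Qed.

Lemma compZl x y z (c : k) (g : hom y z) (f : hom x y) : (c *: g) ∘ f = c *: (g ∘ f).
Proof. by rewrite -[c *: g]addr0 comp_linl comp0l addr0. Qed.

Lemma compZr x y z (c : k) (g : hom y z) (f : hom x y) : g ∘ (c *: f) = c *: (g ∘ f).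
Proof. by rewrite -[c *: f]addr0 comp_linr comp0r addr0. Qed.

(* Equations between composites, in a form that rewrites inside right-nested
   composites. *)
Lemma compE22 x y y' z (a : hom y z) (b : hom x y) (c : hom y' z) (d : hom x y') :
  a ∘ b = c ∘ d -> forall v (h : hom v x), a ∘ (b ∘ h) = c ∘ (d ∘ h).
Proof. by move=> E v h; rewrite !compA E. Qed.

Lemma compE21 x y z (a : hom y z) (b : hom x y) (c : hom x z) :
  a ∘ b = c -> forall v (h : hom v x), a ∘ (b ∘ h) = c ∘ h.
Proof. by move=> E v h; rewrite compA E. Qed.

Lemma compE20 x y (a : hom y x) (b : hom x y) :
  a ∘ b = idm x -> forall v (h : hom v x), a ∘ (b ∘ h) = h.
Proof. by move=> E v h; rewrite compA E comp1m. Qed.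

Lemma epi_zero x y (p : hom x y) :
  (forall z (c : hom y z), c ∘ p = 0 -> c = 0) -> is_epi p.
Proof.
by move=> H z g h E; apply/eqP; rewrite -subr_eq0; apply/eqP/H; rewrite compBl E subrr.
Qed.

Lemma cokernel_epi x y z (f : hom x y) (c : hom y z) : is_cokernel f c -> is_epi c.
Proof.
case=> cf Uc w g h E; have [|u [_ Uu]] := Uc w (g ∘ c).
  by rewrite -compA cf comp0r.
by rewrite -(Uu g (erefl _)) -(Uu h (esym E)).
Qed.

End LinearComposition.

Section FunctorZero.
Variables (k : fieldType) (C D : lincat k) (F : functor C D).

Lemma fmapB x y (f g : hom x y) : fmap F (f - g) = fmap F f - fmap F g.
Proof. by rewrite addrC -scaleN1r fmap_lin scaleN1r addrC. Qed.

Lemma fmap0 x y : fmap F (0 : hom x y) = 0.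
Proof. by rewrite -[0](subrr (0 : hom x y)) fmapB subrr. Qed.

Lemma fmapZ x y (c : k) (f : hom x y) : fmap F (c *: f) = c *: fmap F f.
Proof. by rewrite -[c *: f]addr0 fmap_lin fmap0 addr0. Qed.

End FunctorZero.

Section Transposition.
Variables (k : fieldType) (C D : lincat k) (L : functor C D) (R : functor D C).
Variable a : adjunction L R.

Lemma transR_inj x y (f g : hom (L x) y) : transR a f = transR a g -> f = g.
Proof. by move=> E; rewrite -(transK a f) E transK. Qed.

Lemma transR_comp x y y' (h : hom y y') (f : hom (L x) y) :
  transR a (h ∘ f) = fmap R h ∘ transR a f.
Proof. by rewrite /transR fmapM compA. Qed.

Lemma transR_fmap x x' y (f : hom (L x') y) (g : hom x x') :
  transR a (f ∘ fmap L g) = transR a f ∘ g.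
Proof. by rewrite /transR fmapM -!compA aunit_nat. Qed.

Lemma transL_comp x x' y (f : hom x' (R y)) (g : hom x x') :
  transL a (f ∘ g) = transL a f ∘ fmap L g.
Proof. by rewrite /transL fmapM compA. Qed.

Lemma transL_fmap x y y' (h : hom y y') (f : hom x (R y)) :
  transL a (fmap R h ∘ f) = h ∘ transL a f.
Proof. by rewrite /transL fmapM compA acounit_nat compA. Qed.

Lemma transR_counit y : transR a (acounit a y) = idm (R y).
Proof. exact: adj_triR. Qed.

Lemma left_adjoint_epi x y (p : hom x y) : is_epi p -> is_epi (fmap L p).
Proof.
move=> Ep z g h E; apply: transR_inj; apply: Ep.
by rewrite -!transR_fmap E.
Qed.

Lemma left_adjoint_cokernel x y z w (d : hom x y) (p : hom y z) (f : hom (L y) w) :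
  is_cokernel d p -> f ∘ fmap L d = 0 -> exists h, h ∘ fmap L p = f.
Proof.
case=> _ Hp E; have [|h [Eh _]] := Hp _ (transR a f).
  by rewrite -transR_fmap E /transR fmap0 comp0l.
by exists (transL a h); rewrite -transL_comp Eh transK.
Qed.

End Transposition.

(** Injectivity of transposition forces both the naturality of the unit and the second triangle
    identity, so the unit may be chosen object by object. *)
Definition counit_adjunction (k : fieldType) (C D : lincat k) (L : functor C D)
    (R : functor D C) (c : forall y, hom (L (R y)) y)
    (c_nat : forall y y' (g : hom y y'), c y' ∘ fmap L (fmap R g) = g ∘ c y)
    (t : forall x, hom x (R (L x)))
    (tK : forall x, c (L x) ∘ fmap L (t x) = idm (L x))
    (c_inj : forall x y (f g : hom x (R y)),
      c y ∘ fmap L f = c y ∘ fmap L g -> f = g) : adjunction L R.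
Proof.
refine (@Adjunction k C D L R t c _ c_nat tK _).
- move=> x x' f; apply: c_inj.
  by rewrite !fmapM !compA tK comp1m c_nat -compA tK compm1.
- by move=> y; apply: c_inj; rewrite !fmapM compA c_nat -compA tK fmap1 !compm1.
Defined.

Section NaturalIsoAdjunction.
Variables (k : fieldType) (C D : lincat k) (F : functor C D) (L R : functor D C).
Variables (a : adjunction L F) (t : forall d, hom (L d) (R d)).
Hypothesis t_iso : is_natural_iso t.

Definition iso_inv d : hom (R d) (L d) := sval (cid (t_iso.2 d)).

Lemma iso_invP d : is_inverse (t d) (iso_inv d).
Proof. exact: svalP (cid (t_iso.2 d)). Qed.

Lemma iso_inv_nat d d' (f : hom d d') :
  iso_inv d' ∘ fmap R f = fmap L f ∘ iso_inv d.
Proof.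
rewrite -[fmap R f]compm1 -(iso_invP d).2 (compE22 (esym (t_iso.1 _ _ f))) compA.
by rewrite (iso_invP d').1 comp1m.
Qed.

Definition iso_adjunction : adjunction R F.
Proof.
refine (@Adjunction k D C R F (fun d => fmap F (t d) ∘ aunit a d)
  (fun c => acounit a c ∘ iso_inv (F c)) _ _ _ _).
- by move=> d d' f; rewrite -compA aunit_nat !compA -!fmapM (t_iso.1 _ _ f).
- by move=> c c' g; rewrite -!compA iso_inv_nat !compA acounit_nat.
- move=> d; rewrite fmapM -!compA (compE22 (iso_inv_nat _)) (compE22 (acounit_nat _ _)).
  by rewrite iso_inv_nat (compE20 (adj_triL a d)) (iso_invP d).2.
- move=> c; rewrite fmapM -!compA (compE21 (esym (fmapM F (iso_inv _) _))) (iso_invP _).1.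
  by rewrite fmap1 comp1m adj_triR.
Defined.

End NaturalIsoAdjunction.

(** * Duals in monoidal categories *)

Section MonoidalIdentities.
Variables (k : fieldType) (C : moncat k).
Implicit Types x y z w v : C.

Lemma tmorE' x y x' y' (f : hom x y) (f' : hom x' y') :
  f ⊗₁ f' = (y ◃ f') ∘ (f ▹ x').
Proof. by rewrite -tmorM comp1m compm1. Qed.

Lemma tmorMA x y z x' y' z' (g : hom y z) (f : hom x y) (g' : hom y' z')
    (f' : hom x' y') v (h : hom v (x ⊗ x')) :
  (g ⊗₁ g') ∘ ((f ⊗₁ f') ∘ h) = ((g ∘ f) ⊗₁ (g' ∘ f')) ∘ h.
Proof. by rewrite compA -tmorM. Qed.

Lemma luV_nat x y (f : hom x y) : luV y ∘ f = (𝟙 ◃ f) ∘ luV x.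
Proof.
apply: (iso_mono (is_iso_lu y)).
by rewrite compA luVK comp1m compA lu_nat -compA luVK compm1.
Qed.

Lemma ruV_nat x y (f : hom x y) : ruV y ∘ f = (f ▹ 𝟙) ∘ ruV x.
Proof.
apply: (iso_mono (is_iso_ru y)).
by rewrite compA ruVK comp1m compA ru_nat -compA ruVK compm1.
Qed.

Lemma assocV_nat x y x' y' x'' y'' (f : hom x y) (f' : hom x' y') (f'' : hom x'' y'') :
  assocV y y' y'' ∘ (f ⊗₁ (f' ⊗₁ f'')) = (f ⊗₁ f' ⊗₁ f'') ∘ assocV x x' x''.
Proof. by rewrite -[RHS]compm1 -compA -assocV_natA compm1. Qed.

Lemma triangleV x y : assocV x 𝟙 y ∘ (x ◃ luV y) = ruV x ▹ y.
Proof.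
apply: (iso_mono (is_iso_tmor (is_iso_ru x) (is_iso_id y))).
rewrite -wrM ruVK tmor1 -triangle -compA (compE20 (assocVK _ _ _)).
by rewrite -wlM luVK tmor1.
Qed.

Lemma luVA x y : assoc 𝟙 x y ∘ (luV x ▹ y) = luV (x ⊗ y).
Proof.
apply: (iso_mono (is_iso_lu (x ⊗ y))).
by rewrite luVK compA luA -wrM luVK tmor1.
Qed.

Lemma ruVA x y : assocV x y 𝟙 ∘ (x ◃ ruV y) = ruV (x ⊗ y).
Proof.
apply: (iso_mono (is_iso_ru (x ⊗ y))).
by rewrite ruVK -ruA -compA (compE20 (assocVK _ _ _)) -wlM ruVK tmor1.
Qed.

Lemma luAV x y : (lu x ▹ y) ∘ assocV 𝟙 x y = lu (x ⊗ y).
Proof. by rewrite -luA -compA assocVK compm1. Qed.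

Lemma ruAV x y : ru (x ⊗ y) ∘ assocV x y 𝟙 = x ◃ ru y.
Proof. by rewrite -ruA -compA assocVK compm1. Qed.

Lemma triangleE x y : (ru x ▹ y) ∘ assocV x 𝟙 y = x ◃ lu y.
Proof. by rewrite -triangle -compA assocVK compm1. Qed.

Lemma luV_unit : luV (𝟙 : C) = ruV 𝟙.
Proof. by apply: (iso_mono (is_iso_lu 𝟙)); rewrite luVK lu_unit ruVK. Qed.

Lemma whisker2r x y z w (f : hom z w) : f ▹ (x ⊗ y) = assoc w x y ∘ (f ▹ x ▹ y) ∘ assocV z x y.
Proof. by rewrite assoc_nat tmor1 -compA assocVK compm1. Qed.

Lemma assoc_l x y z w (f : hom z w) :
  assoc x y w ∘ ((x ⊗ y) ◃ f) = (x ◃ (y ◃ f)) ∘ assoc x y z.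
Proof. by rewrite -tmor1 assoc_nat. Qed.

Lemma assoc_m x y z w (f : hom z w) :
  assoc x w y ∘ ((x ◃ f) ▹ y) = (x ◃ (f ▹ y)) ∘ assoc x z y.
Proof. exact: assoc_nat. Qed.

Lemma assoc_r x y z w (f : hom z w) :
  assoc w x y ∘ ((f ▹ x) ▹ y) = (f ▹ (x ⊗ y)) ∘ assoc z x y.
Proof. by rewrite assoc_nat tmor1. Qed.

Lemma assocV_l x y z w (f : hom z w) :
  assocV x y w ∘ (x ◃ (y ◃ f)) = ((x ⊗ y) ◃ f) ∘ assocV x y z.
Proof. by rewrite assocV_nat tmor1. Qed.

Lemma assocV_m x y z w (f : hom z w) :
  assocV x w y ∘ (x ◃ (f ▹ y)) = ((x ◃ f) ▹ y) ∘ assocV x z y.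
Proof. exact: assocV_nat. Qed.

Lemma assocV_r x y z w (f : hom z w) :
  assocV w x y ∘ (f ▹ (x ⊗ y)) = ((f ▹ x) ▹ y) ∘ assocV z x y.
Proof. by rewrite -(tmor1 x y) assocV_nat. Qed.

End MonoidalIdentities.

(** The underlying category stays the same and only the tensor product is reversed, so a statement
    about left actions or left duals, applied to [rev C], is by conversion its mirror image in
    [C]. *)
Definition rev (k : fieldType) (C : moncat k) : moncat k.
Proof.
refine (@MonCat k C (fun x y => y ⊗ x) (fun x y x' y' f f' => f' ⊗₁ f) 𝟙
  _ _ _ _ (fun x y z => assocV z y x) (fun x y z => assoc z y x)
  (fun x => ru x) (fun x => ruV x) (fun x => lu x) (fun x => luV x)
  _ _ _ _ _ _ _ _).
- by move=> *; exact: tmor1.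
- by move=> *; exact: tmorM.
- by move=> *; exact: tmor_linr.
- by move=> *; exact: tmor_linl.
- by move=> x y z; split; [exact: assocVK | exact: assocK].
- exact: ruP.
- exact: luP.
- by move=> *; exact: assocV_nat.
- by move=> *; exact: ru_nat.
- by move=> *; exact: lu_nat.
- move=> x y z w; rewrite -[LHS]compm1 -[RHS]compm1 -!compA.
  exact/esym/pentagonB.
- by move=> x y; exact: triangleE.
Defined.

Lemma F2_assocV (k : fieldType) (C D : moncat k) (F : laxmon C D) x y z :
  fmap F (assocV x y z) ∘ F2 F x (y ⊗ z) ∘ (F x ◃ F2 F y z) =
  F2 F (x ⊗ y) z ∘ (F2 F x y ▹ F z) ∘ assocV (F x) (F y) (F z).
Proof.
apply: (iso_epi (is_iso_assoc (F x) (F y) (F z))).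
rewrite -[RHS]compA assocK compm1 -!compA (compA (F2 F x _)) -F2_assoc -!compA.
by rewrite (compA (fmap F _)) -fmapM assocK fmap1 comp1m.
Qed.

Definition rev_lax (k : fieldType) (C D : moncat k) (F : laxmon C D) :
  laxmon (rev C) (rev D).
Proof.
refine (@LaxMon k (rev C) (rev D) F (fun x y => F2 F y x) (F0 F) _ _ _ _).
- by move=> x y x' y' f f'; exact: (F2_nat F f' f).
- by move=> x y z; exact: (F2_assocV F z y x).
- by move=> x; exact: (F2_ru F x).
- by move=> x; exact: (F2_lu F x).
Defined.

Definition rev_functor (k : fieldType) (C D : moncat k) (F : tensor_functor C D) :
  tensor_functor (rev C) (rev D) :=
  @TensorFunctor k (rev C) (rev D) (rev_lax F) (fun x y => F2V F y x) (F0V F)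
    (fun x y => F2P F y x) (F0P F) (@tf_exact _ _ _ F).

(* [y] is a right dual of [x], the duality being [e] and [c]. *)
Definition dual_pair (k : fieldType) (C : moncat k) (x y : C) (e : hom (y ⊗ x) 𝟙)
    (c : hom 𝟙 (x ⊗ y)) : Prop := is_dual (DualData e c).

(** Reversal exchanges the two snake identities. *)
Lemma dual_pair_rev (k : fieldType) (C : moncat k) (x y : C) (e : hom (y ⊗ x) 𝟙)
    (c : hom 𝟙 (x ⊗ y)) : dual_pair e c -> dual_pair (C := rev C) (x := y) (y := x) e c.
Proof. by case. Qed.

Section Capping.
Variables (k : fieldType) (C : moncat k).
Implicit Types x y z w v : C.

(* [cap], [cup] and several constants below are locked because rewriting with
   [compA], [wlM] or [wrM] would otherwise unfold them. *)
Definition cap x y (e : hom (x ⊗ y) 𝟙) z : hom (x ⊗ (y ⊗ z)) z :=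
  locked (lu z ∘ (e ▹ z) ∘ assocV x y z).
Definition cup x y (c : hom 𝟙 (x ⊗ y)) z : hom z (x ⊗ (y ⊗ z)) :=
  locked (assoc x y z ∘ (c ▹ z) ∘ luV z).

Lemma capE x y (e : hom (x ⊗ y) 𝟙) z : cap e z = lu z ∘ (e ▹ z) ∘ assocV x y z.
Proof. by rewrite /cap -lock. Qed.

Lemma cupE x y (c : hom 𝟙 (x ⊗ y)) z : cup c z = assoc x y z ∘ (c ▹ z) ∘ luV z.
Proof. by rewrite /cup -lock. Qed.

Lemma cap_nat x y (e : hom (x ⊗ y) 𝟙) z w (f : hom z w) :
  cap e w ∘ (x ◃ (y ◃ f)) = f ∘ cap e z.
Proof.
rewrite !capE -!compA assocV_nat tmor1 (compE22 (exch _ _)).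
by rewrite (compE22 (lu_nat _)).
Qed.

Lemma cup_nat x y (c : hom 𝟙 (x ⊗ y)) z w (f : hom z w) :
  (x ◃ (y ◃ f)) ∘ cup c z = cup c w ∘ f.
Proof.
rewrite !cupE -!compA luV_nat (compE22 (exch _ _)).
by rewrite -tmor1 assoc_natA.
Qed.

Section DualPair.
Variables (x y : C) (e : hom (y ⊗ x) 𝟙) (c : hom 𝟙 (x ⊗ y)).
Hypothesis ec : dual_pair e c.

(** With a spectator [z] the snake identities absorb all associators and become the triangle
    identities of the adjunction between [y ⊗ -] and [x ⊗ -]. *)
Lemma snake1 z : (x ◃ cap e z) ∘ cup c (x ⊗ z) = idm (x ⊗ z).
Proof.
have [E _] := ec.
have E' : (x ◃ e) ∘ (assoc x y x ∘ ((c ▹ x) ∘ luV x)) = ruV x.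
  by rewrite !compA E -compA luVK compm1.
rewrite !capE !cupE !wlM -(luVA x z) (whisker2r x z c) -!compA.
rewrite (compE20 (assocK _ _ _)) -(wrM z (c ▹ x) (luV x)) pentagonA assocKl.
rewrite -(assoc_natA (idm x) e (idm z)) (compA (x ◃ lu z)) triangle.
by rewrite -!wrM E' ruVK tmor1.
Qed.

Lemma snake2 z : cap e (y ⊗ z) ∘ (y ◃ cup c z) = idm (y ⊗ z).
Proof.
have [_ E] := ec.
have E' : lu y ∘ ((e ▹ y) ∘ (assocV y x y ∘ ((y ◃ c) ∘ ruV y))) = idm y.
  have := congr1 (fun f => lu y ∘ f ∘ ruV y) E; rewrite /= -!compA => ->.
  by rewrite ruVK compm1 luVK.
have EV : y ◃ luV z = assoc y 𝟙 z ∘ (ruV y ▹ z) by rewrite -triangleV compA assocVK comp1m.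
rewrite !capE !cupE !wlM -!compA EV -assoc_natA -(wrM z (y ◃ c)) pentagonC.
rewrite -(tmor1 y z) -assoc_natA -wrM (compE21 (luA _ _)).
by rewrite -!wrM E' tmor1.
Qed.

End DualPair.
End Capping.

Section Curry.
Variables (k : fieldType) (C : moncat k).
Implicit Types x y z : C.

Definition curry x y (d : dual_data y) (f : hom (x ⊗ y) 𝟙) : hom x (dob d) :=
  lu (dob d) ∘ (f ▹ dob d) ∘ assocV x y (dob d) ∘ (x ◃ coev d) ∘ ruV x.

Lemma mate_curry x y (dx : dual_data x) (dy : dual_data y) (f : hom x y) :
  mate dx dy f = curry dx (ev dy ∘ (dob dy ◃ f)).
Proof. by rewrite /mate /curry wrM -!compA. Qed.

Lemma evK x y (d : dual_data y) (f : hom x (dob d)) :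
  is_dual d -> curry d (ev d ∘ (f ▹ y)) = f.
Proof.
case=> _ E; rewrite /curry wrM -!compA -(assocV_natA f (idm y) (idm (dob d))) tmor1.
rewrite (compA (f ▹ _)) exch -!compA -ruV_nat.
have := congr1 (fun g => lu (dob d) ∘ g ∘ (ruV (dob d) ∘ f)) E.
rewrite -!compA => ->.
by rewrite (compE20 (ruVK _)) compA luVK comp1m.
Qed.

Lemma curryK x y (d : dual_data y) (f : hom (x ⊗ y) 𝟙) :
  is_dual d -> ev d ∘ (curry d f ▹ y) = f.
Proof.
case=> E _; rewrite /curry !wrM -!compA.
rewrite -(luA (dob d) y) -!compA (compE22 (esym (lu_nat (ev d)))) assoc_natA tmor1.
rewrite -exchA lu_unit (compE22 (ru_nat f)) -ruA -(tmor1 x y) -!compA assoc_natA.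
rewrite pentagonA assocVKr assoc_natA.
have E' : ru y ∘ ((y ◃ ev d) ∘ (assoc y (dob d) y ∘ (coev d ▹ y))) = lu y.
  by rewrite (compA (y ◃ ev d)) E compA ruVK comp1m.
by rewrite !(compE21 (esym (wlM _ _ _))) -!compA E' (compE21 (triangle _ _)) -wrM ruVK tmor1 compm1.
Qed.

Lemma ev_inj x y (d : dual_data y) (f g : hom x (dob d)) :
  is_dual d -> ev d ∘ (f ▹ y) = ev d ∘ (g ▹ y) -> f = g.
Proof. by move=> dP E; rewrite -(evK f dP) E evK. Qed.

Lemma mateP x y (dx : dual_data x) (dy : dual_data y) (f : hom x y) :
  is_dual dx -> ev dx ∘ (mate dx dy f ▹ x) = ev dy ∘ (dob dy ◃ f).
Proof. by move=> dP; rewrite mate_curry curryK. Qed.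

End Curry.

Section TensorAdjunction.
Variables (k : fieldType) (C : moncat k).

Definition tensl (x : C) : functor C C.
Proof.
refine (@Functor k C C (fun z => x ⊗ z) (fun z w f => x ◃ f) _ _ _).
- by move=> z; exact: tmor1.
- by move=> *; exact: wlM.
- by move=> z w; exact: tmor_linr.
Defined.

Definition tensl_adj (x y : C) (e : hom (y ⊗ x) 𝟙) (c : hom 𝟙 (x ⊗ y))
    (ec : dual_pair e c) : adjunction (tensl y) (tensl x) :=
  @Adjunction k C C (tensl y) (tensl x) (cup c) (cap e)
    (fun z w f => esym (cup_nat c f)) (fun z w f => cap_nat e f)
    (snake2 ec) (snake1 ec).

End TensorAdjunction.

Lemma left_adjoint_projective (k : fieldType) (C D : lincat k) (L : functor C D)
    (R : functor D C) (a : adjunction L R) (p : C) :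
  (forall x y (f : hom x y), is_epi f -> is_epi (fmap R f)) ->
  is_projective p -> is_projective (L p).
Proof.
move=> HR pP y z q f /HR/pP-/(_ (transR a f)) [g E].
by exists (transL a g); rewrite -transL_fmap E transK.
Qed.

Section RigidTensor.
Variables (k : fieldType) (C : ftcat k).
Implicit Types x y z : C.

Lemma dual_pair_rd x : dual_pair (ev (rd C x)) (coev (rd C x)).
Proof. by have := rdP C x; case: (rd C x). Qed.

Lemma dual_pair_ld x : dual_pair (lev C x) (lcoev C x).
Proof. exact: ldP. Qed.

Lemma epi_wl x y z (f : hom y z) : is_epi f -> is_epi (x ◃ f).
Proof. exact: (left_adjoint_epi (tensl_adj (dual_pair_ld x))). Qed.

Lemma epi_wr x y z (f : hom y z) : is_epi f -> is_epi (f ▹ x).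
Proof.
exact: (left_adjoint_epi (tensl_adj (dual_pair_rev (dual_pair_rd x)))).
Qed.

Lemma cokernel_wr x y z w u (d : hom y z) (p : hom z w) (f : hom (z ⊗ x) u) :
  is_cokernel d p -> f ∘ (d ▹ x) = 0 -> exists h, h ∘ (p ▹ x) = f.
Proof.
exact: (left_adjoint_cokernel (tensl_adj (dual_pair_rev (dual_pair_rd x)))).
Qed.

Lemma projective_tensor x p : is_projective p -> is_projective (p ⊗ x).
Proof.
apply: (left_adjoint_projective (tensl_adj (dual_pair_rev (dual_pair_rd x)))).
by move=> y z f; exact: epi_wr.
Qed.

End RigidTensor.

(** This form and the next one discharge the hypothesis [rigidC] of later sections, for [C] and for
    [rev C] respectively. *)
Lemma rigid_right_duals (k : fieldType) (C : ftcat k) (x : C) :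
  exists y (e : hom (y ⊗ x) 𝟙) (c : hom 𝟙 (x ⊗ y)), dual_pair e c.
Proof. by exists (dual x), (ev (rd C x)), (coev (rd C x)); exact: dual_pair_rd. Qed.

Lemma rigid_left_duals (k : fieldType) (C : ftcat k) (x : rev C) :
  exists (y : rev C) (e : hom (y ⊗ x) 𝟙) (c : hom 𝟙 (x ⊗ y)), dual_pair e c.
Proof. by exists (lob C x), (lev C x), (lcoev C x); exact: (dual_pair_rev (dual_pair_ld x)). Qed.

Section DualOfTensor.
Variables (k : fieldType) (C : moncat k).
Implicit Types x y z w : C.

(** The instance at [𝟙] is the ordinary snake identity tensored with [𝟙], and [wr_inj] removes that
    factor. *)
Lemma dual_pair_snakes x y (e : hom (y ⊗ x) 𝟙) (c : hom 𝟙 (x ⊗ y)) :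
  (forall z, (x ◃ cap e z) ∘ cup c (x ⊗ z) = idm (x ⊗ z)) ->
  (forall z, cap e (y ⊗ z) ∘ (y ◃ cup c z) = idm (y ⊗ z)) -> dual_pair e c.
Proof.
move=> /(_ 𝟙) E1 /(_ 𝟙) E2; split=> /=.
- have : ru x ∘ ((x ◃ e) ∘ (assoc x y x ∘ ((c ▹ x) ∘ luV x))) = idm x.
    apply: wr_inj; rewrite tmor1 -{}E1 capE cupE !wlM !wrM -!compA -(luVA x 𝟙).
    rewrite (whisker2r x 𝟙 c) -!compA (compE20 (assocK _ _ _)) pentagonA assocKl.
    by rewrite -(assoc_natA (idm x) e (idm 𝟙)) (compE21 (triangle _ _)).
  move=> E; rewrite -[RHS]compm1 -[RHS]compA; apply: (iso_mono (is_iso_ru x)).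
  rewrite compm1 (compE20 (ruVK _)); apply: (iso_epi (is_iso_luV x)).
  by rewrite luVK -!compA.
- have : lu y ∘ ((e ▹ y) ∘ (assocV y x y ∘ ((y ◃ c) ∘ ruV y))) = idm y.
    apply: wr_inj; rewrite tmor1 -{}E2 capE cupE !wlM !wrM -!compA.
    have EV : y ◃ luV 𝟙 = assoc y 𝟙 𝟙 ∘ (ruV y ▹ 𝟙).
      by rewrite -triangleV compA assocVK comp1m.
    rewrite (whisker2r y 𝟙 e) -!compA EV -assoc_natA pentagonC.
    by rewrite (compE20 (assocK _ _ _)) (compE21 (luA _ _)).
  move=> E; apply: (iso_mono (is_iso_lu y)); apply: (iso_epi (is_iso_ruV y)).
  by rewrite -!compA E ruVK compm1 luVK.
Qed.

Variables (x y : C) (dx : dual_data x) (dy : dual_data y).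
Hypotheses (dxP : is_dual dx) (dyP : is_dual dy).

Lemma cap_tensor (a b z w : C) (e : hom (a ⊗ b) 𝟙) :
  (cap e z ▹ w) ∘ assocV a (b ⊗ z) w = cap e (z ⊗ w) ∘ (a ◃ assoc b z w).
Proof.
rewrite !capE !wrM -!compA -[assocV a (b ⊗ z) w]compm1.
rewrite -[idm (a ⊗ (b ⊗ z ⊗ w))](tmor1 a) -(assocK b z w) wlM pentagonB -assocV_natA tmor1.
by rewrite (compE21 (luAV _ _)).
Qed.

Lemma cup_tensor (a b z w : C) (c : hom 𝟙 (a ⊗ b)) :
  cup c z ▹ w = assocV a (b ⊗ z) w ∘ (a ◃ assocV b z w) ∘ cup c (z ⊗ w).
Proof.
rewrite !cupE !wrM -luVA (whisker2r z w c) -!compA (compE20 (assocK _ _ _)).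
by rewrite pentagonA assocKl assocKA.
Qed.

(** Two nested caps: the snake identities for [x ⊗ y] then reduce to those of the factors, one
    inside the other. *)
Lemma cap_dual_tensor z : cap (ev (dual_tensor dx dy)) z =
  cap (ev dy) z ∘ (dob dy ◃ cap (ev dx) (y ⊗ z)) ∘ assoc (dob dy) (dob dx) (x ⊗ (y ⊗ z)) ∘
    ((dob dy ⊗ dob dx) ◃ assoc x y z).
Proof.
rewrite {1}capE /= !wrM -capE -!compA.
set a := dob dy; set b := dob dx.
have E : (assoc a b (x ⊗ y) ▹ z) ∘ assocV (a ⊗ b) (x ⊗ y) z =
    assocV a (b ⊗ (x ⊗ y)) z ∘ ((a ◃ assocV b (x ⊗ y) z) ∘ assoc a b (x ⊗ y ⊗ z)).
  by rewrite -[assoc a b (x ⊗ y ⊗ z)]compm1 -pentagonD compm1 assocKA.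
rewrite E -assocV_natA (compE21 (esym (wlM _ _ _))) cap_tensor wlM -!compA.
by rewrite -[in a ⊗ b ◃ _](tmor1 a b) -assoc_nat [cap (ev dy) z]capE -!compA.
Qed.

Lemma cup_dual_tensor z : cup (coev (dual_tensor dx dy)) z =
  ((x ⊗ y) ◃ assocV (dob dy) (dob dx) z) ∘ assocV x y (dob dy ⊗ (dob dx ⊗ z)) ∘
    (x ◃ cup (coev dy) (dob dx ⊗ z)) ∘ cup (coev dx) z.
Proof.
rewrite {1}cupE /= !wrM -cupE -!compA.
have -> : (coev dx ▹ z) ∘ luV z = assocV x (dob dx) z ∘ cup (coev dx) z.
  by rewrite !cupE -!compA assocKA.
rewrite -assocV_natA cup_tensor !wlM -!compA pentagonB assocVKA.
by rewrite assocV_natA tmor1.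
Qed.

Lemma dual_tensorP : is_dual (dual_tensor dx dy).
Proof.
have dP : dual_pair (ev dx) (coev dx) by exact: dxP.
have dP' : dual_pair (ev dy) (coev dy) by exact: dyP.
apply: dual_pair_snakes => z; rewrite cap_dual_tensor cup_dual_tensor.
- rewrite !wlM -!compA.
  rewrite (compE21 (esym (wlM _ (_ ◃ assoc x y z) _))) -assocV_l wlM -!compA.
  rewrite -!(compE22 (assocV_l _ _ _)) !(compE21 (esym (wlM x _ _))) -!compA.
  rewrite !(compE21 (esym (wlM y _ _))) -!compA (compE20 (assocVK _ _ _)).
  rewrite -(wlM (dob dy)) (wlM y) -compA cup_nat (compE20 (snake1 dP' _)).
  by rewrite wlM -compA cup_nat (compE20 (snake1 dP _)) assocK.
- rewrite !wlM -!compA.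
  rewrite (compE21 (esym (wlM (dob dy ⊗ dob dx) (assoc x y _) _))) assoc_l wlM -!compA.
  rewrite (compE21 (esym (wlM _ (assoc x y _) _))) assocVK tmor1 comp1m.
  rewrite !(compE21 (esym (wlM (dob dy ⊗ dob dx) _ _))) -wlM assoc_l.
  rewrite (compE21 (esym (wlM (dob dy) _ _))) -!compA.
  rewrite (compE21 (esym (wlM x _ _))) (wlM (dob dx)) (compA (cap (ev dx) _)) cap_nat -compA.
  rewrite (snake2 dP) compm1 wlM -compA (compE22 (cap_nat (ev dy) _)).
  by rewrite (compE20 (snake2 dP' _)) assocK.
Qed.

Lemma dual_unitP : is_dual (dual_unit C).
Proof.
split; rewrite /=.
- by rewrite triangle -wrM -lu_unit luVK tmor1 -luV_unit luK.
- by rewrite -compA triangleV lu_unit -wrM ruVK tmor1 luV_unit ruK.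
Qed.

End DualOfTensor.

(** * Pivotal structures and symmetric Frobenius algebras *)

Section EvaluationLeft.
Variables (k : fieldType) (C : moncat k).

Lemma ev_injl (x y : C) (d : dual_data y) (f g : hom x y) :
  is_dual d -> ev d ∘ (dob d ◃ f) = ev d ∘ (dob d ◃ g) -> f = g.
Proof.
by move=> dP; exact: (ev_inj (C := rev C) (d := DualData (C := rev C) (ev d) (coev d))
  (dual_pair_rev dP)).
Qed.

Lemma curryl (x y : C) (d : dual_data y) (f : hom (dob d ⊗ x) 𝟙) :
  is_dual d -> exists g : hom x y, ev d ∘ (dob d ◃ g) = f.
Proof.
move=> dP; exact: (ex_intro _ _ (curryK (C := rev C)
  (d := DualData (C := rev C) (ev d) (coev d)) f (dual_pair_rev dP))).
Qed.

Lemma snake_ev (y z : C) (e : hom (y ⊗ z) 𝟙) (c : hom 𝟙 (z ⊗ y)) :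
  dual_pair e c -> cap e y ∘ (y ◃ c) = ru y.
Proof. by case=> _ /= E; rewrite capE -!compA (compA (e ▹ y)) E (compE20 (luVK y)). Qed.

End EvaluationLeft.

Section PivotalPairing.
Variables (k : fieldType) (C : pftcat k).
Implicit Types x y z : C.
Local Notation rdC := (rd C).

(** The evaluation by which the pivotal structure makes the right dual of [y] a left dual as
    well. *)
Definition evp y : hom (y ⊗ dual y) 𝟙 := ev (rdC (dual y)) ∘ (pivot C y ▹ dual y).

Lemma dual_morP x y (f : hom x y) :
  ev (rdC x) ∘ (dual_mor f ▹ x) = ev (rdC y) ∘ (dual y ◃ f).
Proof. exact: (mateP _ _ (rdP C x)). Qed.

Lemma evp_inj x y (f g : hom x (dual y)) :
  evp y ∘ (y ◃ f) = evp y ∘ (y ◃ g) -> f = g.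
Proof.
rewrite /evp -!compA !exch !compA => E; apply: (ev_injl (rdP C (dual y))).
exact: (iso_epi (is_iso_tmor (piv_iso (pivot C) y) (is_iso_id x))).
Qed.

Lemma evp_dual_mor x y (f : hom x y) :
  evp x ∘ (x ◃ dual_mor f) = evp y ∘ (f ▹ dual y).
Proof.
rewrite /evp -!compA exch compA -dual_morP -!compA -!wrM.
by rewrite (piv_nat (pivot C)).
Qed.

Lemma dual0P : lu 𝟙 ∘ (dual0 C ▹ 𝟙) = ev (rdC 𝟙).
Proof.
by rewrite [LHS](mateP (rdC 𝟙) (idm 𝟙) (dual_unitP C)) tmor1 compm1.
Qed.

Lemma ddual0P : ev (rdC (dual 𝟙)) ∘ (ddual0 C ▹ dual 𝟙) = lu 𝟙 ∘ (𝟙 ◃ dual0 C).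
Proof. exact: (mateP (dual_unit C) (dual0 C) (rdP C (dual 𝟙))). Qed.

Lemma dual2P x y (d := dual_tensor (rdC x) (rdC y)) :
  ev d ∘ (dual2 x y ▹ (x ⊗ y)) = ev (rdC (x ⊗ y)).
Proof.
by rewrite [LHS](mateP _ (idm (x ⊗ y)) (dual_tensorP (rdP C x) (rdP C y))) tmor1 compm1.
Qed.

Lemma ddual2P x y : ev (rdC (dual (x ⊗ y))) ∘ (ddual2 x y ▹ dual (x ⊗ y)) =
  ev (dual_tensor (rdC (dual y)) (rdC (dual x))) ∘
    ((dual (dual x) ⊗ dual (dual y)) ◃ dual2 x y).
Proof.
exact: (mateP (dual_tensor (rdC (dual y)) (rdC (dual x))) (dual2 x y) (rdP C (dual (x ⊗ y)))).
Qed.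

(** Dualizing an evaluation gives a coevaluation. Both sides are paired with [dual y ⊗ y], where a
    snake identity cancels the coevaluation. *)
Lemma dual2_ev y :
  dual2 (dual y) y ∘ dual_mor (ev (rdC y)) = coev (rdC (dual y)) ∘ dual0 C.
Proof.
have dP := dual_tensorP (rdP C (dual y)) (rdP C y).
apply: (ev_inj dP); rewrite (wrM _ (dual2 _ _)) (wrM _ (coev _)) (compA _ (dual2 _ _ ▹ _)).
rewrite dual2P dual_morP.
rewrite /= -capE -!compA.
have E : assoc (dual y) (dual (dual y)) (dual y ⊗ y) ∘ (coev (rdC (dual y)) ▹ (dual y ⊗ y))
  = cup (coev (rdC (dual y))) (dual y ⊗ y) ∘ lu _.
  by rewrite cupE -compA luK compm1.
rewrite (compE22 E) (compE20 (snake1 (dual_pair_rd _) _)).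
by rewrite (compE22 (esym (lu_nat _))) -exch compA dual0P.
Qed.

(* Apply naturality of the pivotal structure to [ev : y^∨ ⊗ y -> 𝟙]; this is where
   its monoidality is needed. *)
Lemma evp_dual y : evp (dual y) ∘ (dual y ◃ pivot C y) = ev (rdC y).
Proof.
(* The double dual functor carries the evaluation of [y] to the evaluation of [dual (dual y)]. *)
have E : dual_mor (dual_mor (ev (rdC y))) ∘ ddual2 (dual y) y =
    ddual0 C ∘ ev (rdC (dual (dual y))).
  apply: (ev_inj (rdP C (dual 𝟙))).
  rewrite (wrM _ (dual_mor _)) (wrM _ (ddual0 C)) compA dual_morP.
  rewrite -compA -exch compA ddual2P -compA -wlM dual2_ev.
  rewrite (compA _ (ddual0 C ▹ _)) ddual0P -(compA (lu 𝟙)) -exch lu_unit (compE22 (ru_nat _)).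
  rewrite wlM /= -capE -!compA; congr (_ ∘ _).
  rewrite (compE22 (assoc_l _ _ _)) (compE21 (esym (wlM _ _ _))).
  by rewrite (snake_ev (dual_pair_rd _)) (compE21 (ruA _ _)).
apply: (iso_mono (piv_iso (pivot C) 𝟙)).
rewrite [RHS](piv_nat (pivot C)) (piv_tensor (pivot C)) (compE22 E) (piv_unit (pivot C)).
by rewrite /evp -!compA -tmorE.
Qed.

(* [g] is [f] rotated by the pivotal structure. *)
Definition cyclic_pair x y (f : hom (x ⊗ y) 𝟙) (g : hom (y ⊗ x) 𝟙) : Prop :=
  exists h : hom x (dual y), f = ev (rdC y) ∘ (h ▹ y) /\ g = evp y ∘ (y ◃ h).

Lemma cyclic_pair_nat x y x' y' (f : hom (x ⊗ y) 𝟙) (g : hom (y ⊗ x) 𝟙)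
    (a : hom x' x) (b : hom y' y) :
  cyclic_pair f g -> cyclic_pair (f ∘ (a ⊗₁ b)) (g ∘ (b ⊗₁ a)).
Proof.
case=> h [-> ->]; exists (dual_mor b ∘ (h ∘ a)); split.
- rewrite (wrM _ (dual_mor b)) (compA _ (dual_mor b ▹ _)) dual_morP -!compA -exch.
  by rewrite -tmorE -tmorM comp1m.
- rewrite (wlM _ (dual_mor b)) (compA _ (_ ◃ dual_mor b)) evp_dual_mor -!compA -tmorE.
  by rewrite -tmorM comp1m.
Qed.

(** Identifies [lob C y] with [dual y] compatibly with the evaluations [lev] and [evp], so that
    symmetry can be expressed by right duals alone. *)
Lemma dual_lobP y : evp y ∘ (y ◃ (dual_lob y ∘ pivot C (lob C y))) = lev C y.
Proof.
have sP := mateP (DualData (lev C y) (lcoev C y)) (idm (lob C y)) (rdP C (lob C y)).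
rewrite tmor1 compm1 /= in sP.
rewrite (wlM _ (dual_lob y)) (compA _ (_ ◃ dual_lob y)) evp_dual_mor -compA exch compA.
by rewrite evp_dual sP.
Qed.

(** The two sides of [is_symmetric] are the transposes of the form [cone fr ∘ amul A] under [ev] and
    under [evp]; they agree exactly when a single [h] serves both. *)
Lemma symmetricP (A : algebra C) (fr : frobenius_structure A) :
  is_symmetric fr <-> cyclic_pair (cone fr ∘ amul A) (cone fr ∘ amul A).
Proof.
rewrite /is_symmetric; move: (cone fr ∘ amul A) => f.
set f1 := (X in X = _); set f2 := (X in _ = X).
have E1 : ev (rdC A) ∘ (f1 ▹ A) = f by exact: (curryK f (rdP C A)).
have E2 : evp A ∘ (A ◃ f2) = f.
  have -> : f2 = (dual_lob A ∘ pivot C (lob C A)) ∘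
      (ru _ ∘ ((lob C A ◃ f) ∘ cup (lcoev C A) A)).
    by rewrite /f2 -!compA cupE (tmorE (pivot C _) f) -!compA (compE22 (ru_nat _)).
  rewrite (wlM _ (dual_lob A ∘ _)) (compA _ (_ ◃ (dual_lob A ∘ _))) dual_lobP.
  rewrite !wlM -ruAV (compA (lev C A)) (compA (lev C A)) -ru_nat -lu_unit -capE.
  by rewrite (compE22 (cap_nat _ _)) (snake2 (dual_pair_ld _)) compm1.
split=> [E|[h [Eh Eh']]]; first by exists f1; rewrite {2}E E1 E2.
transitivity h; first by apply: (ev_inj (rdP C A)); rewrite E1.
by apply: evp_inj; rewrite E2.
Qed.

End PivotalPairing.

(** * Frobenius structures and nondegenerate forms *)

Section LeftMultiplication.
Variables (k : fieldType) (C : moncat k) (A : algebra C).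
Implicit Types z w : C.

Definition lmul z : hom (A ⊗ (A ⊗ z)) (A ⊗ z) := locked ((amul A ▹ z) ∘ assocV A A z).

Lemma lmulE z : lmul z = (amul A ▹ z) ∘ assocV A A z.
Proof. by rewrite /lmul -lock. Qed.

Lemma lmul_nat z w (f : hom z w) : (A ◃ f) ∘ lmul z = lmul w ∘ (A ◃ (A ◃ f)).
Proof. by rewrite !lmulE -!compA assocV_l (compE22 (exch _ _)). Qed.

Lemma lmulA z : lmul z ∘ (A ◃ lmul z) = lmul z ∘ lmul (A ⊗ z).
Proof.
rewrite !lmulE !wlM -!compA (compE22 (assocV_m _ _ _)) (compE22 (assocV_r _ _ _)).
rewrite -[assocV A A (A ⊗ z)]compm1 -(pentagonB (idm _)) compm1.
by rewrite !(compE21 (esym (wrM _ (amul A) _))) amulA !wrM -!compA assocVKr.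
Qed.

(** By associativity the map a ↦ a b is left linear for every [b]. Applied to [rev_algebra A] this
    also yields the right-handed Frobenius law. *)
Lemma lmul_cmul (b : hom 𝟙 (A ⊗ A)) (d := lmul A ∘ (A ◃ b) ∘ ruV A) :
  lmul A ∘ (A ◃ d) = d ∘ amul A.
Proof.
rewrite /d !wlM !compA lmulA -!compA -(compE22 (lmul_nat _)) ruV_nat; congr (_ ∘ (_ ∘ _)).
by rewrite lmulE -compA ruVA.
Qed.

End LeftMultiplication.

Definition rev_algebra (k : fieldType) (C : moncat k) (A : algebra C) : algebra (rev C).
Proof.
refine (@Algebra k (rev C) A (amul A) (aone A) _ (amulm1 A) (amul1m A)).
by rewrite /= amulA -compA assocVK compm1.
Defined.

Section FrobeniusDuality.
Variables (k : fieldType) (C : moncat k) (A : algebra C).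

Lemma frobenius_dual_pair (fr : frobenius_structure A) :
  dual_pair (cone fr ∘ amul A) (cmul fr ∘ aone A).
Proof.
split=> /=.
- have E : (A ◃ amul A) ∘ (assoc A A A ∘ ((cmul fr ▹ A) ∘ (aone A ▹ A))) = cmul fr ∘ lu A.
    by rewrite (compA (assoc _ _ _)) compA (compA (A ◃ _)) frobr -compA amul1m.
  by rewrite (wlM _ (cone fr)) (wrM _ (cmul fr)) -!compA E compA cmulm1.
- have E : (amul A ▹ A) ∘ (assocV A A A ∘ ((A ◃ cmul fr) ∘ (A ◃ aone A))) = cmul fr ∘ ru A.
    by rewrite (compA (assocV _ _ _)) compA (compA (amul A ▹ _)) frobl -compA amulm1.
  by rewrite (wrM _ (cone fr)) (wlM _ (cmul fr)) -!compA E compA cmul1m.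
Qed.

Section FromDualPair.
Variables (l : hom A 𝟙) (b : hom 𝟙 (A ⊗ A)).
Hypothesis lb : dual_pair (l ∘ amul A) b.

Lemma cap_lmul z : cap (l ∘ amul A) z = lu z ∘ (l ▹ z) ∘ lmul A z.
Proof. by rewrite capE lmulE wrM -!compA. Qed.

(** The Casimir property a b = b a of the copairing. A snake inserted on the left side creates a
    pairing with a product, and associativity of the form moves the factor a to the other leg. *)
Lemma casimir_central z :
  lmul A (A ⊗ z) ∘ (A ◃ cup b z) = (A ◃ lmul A z) ∘ cup b (A ⊗ z).
Proof.
rewrite -[LHS]comp1m -(snake1 lb) -compA -cup_nat compA -wlM; congr (_ ◃ _ ∘ _).
rewrite cap_lmul -compA (wlM _ (lmul A _)) (compE22 (lmulA _ _)) -lmul_nat.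
by rewrite (compA (lu _ ∘ _)) -cap_lmul (compE20 (snake2 lb _)).
Qed.

Definition casimir_cmul : hom A (A ⊗ A) := lmul A A ∘ (A ◃ b) ∘ ruV A.

Lemma casimir_cmul_fam z : casimir_cmul ▹ z = assocV A A z ∘ (lmul A (A ⊗ z) ∘ (A ◃ cup b z)).
Proof.
rewrite /casimir_cmul !lmulE cupE !wrM !wlM -!compA (compE22 (assocV_r _ _ _)).
by rewrite -pentagonB assocKl (compE22 (assocV_m _ _ _)) triangleV.
Qed.

Lemma casimir_cmulE :
  casimir_cmul = (A ◃ amul A) ∘ assoc A A A ∘ (b ▹ A) ∘ luV A.
Proof.
apply: wr_inj; rewrite casimir_cmul_fam casimir_central lmulE cupE !wrM !wlM -!compA.
rewrite (whisker2r A 𝟙 b) -luVA -!compA (compE20 (assocK _ _ _)) pentagonA assocKl.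
by rewrite (compE22 (assocV_m _ _ _)) assocKA.
Qed.

Lemma casimir_cmulA : assoc A A A ∘ (casimir_cmul ▹ A) ∘ casimir_cmul =
  (A ◃ casimir_cmul) ∘ casimir_cmul.
Proof.
(* Coassociativity with a spectator. For two copies b, b' of the copairing, the Casimir property
   turns both sides into b_1 ⊗ b_2 a b'_1 ⊗ b'_2. *)
have E z : lmul A (A ⊗ (A ⊗ z)) ∘ ((A ◃ cup b (A ⊗ z)) ∘ (lmul A (A ⊗ z) ∘ (A ◃ cup b z))) =
    (A ◃ (lmul A (A ⊗ z) ∘ (A ◃ cup b z))) ∘ (lmul A (A ⊗ z) ∘ (A ◃ cup b z)).
  rewrite [X in _ = _ ∘ X]casimir_central (compE22 (casimir_central _)).
  rewrite !(compA (cup b _)) -(cup_nat b (lmul _ _)) -!compA -(cup_nat b (_ ◃ cup _ _)).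
  rewrite !(compE21 (esym (wlM A _ _))); congr (_ ◃ _ ∘ _).
  by rewrite -[RHS]compA lmul_nat lmulA -compA.
apply: wr_inj; rewrite (wrM _ (_ ∘ _) casimir_cmul) (wrM _ (assoc A A A))
  (wrM _ (A ◃ casimir_cmul)).
rewrite (casimir_cmul_fam 𝟙) -!compA -(compE22 (assocV_r _ _ _)) casimir_cmul_fam.
rewrite -!compA -pentagonB assocVKr E wlM -!compA.
by rewrite -(compE22 (assocV_m _ _ _)) casimir_cmul_fam !wlM -!compA.
Qed.

(** With the comultiplication a ↦ a b = b a, the counit laws are the two snake identities and the
    Frobenius laws are linearity on either side. *)
Lemma frobenius_of_dual_pair : exists fr : frobenius_structure A, cone fr = l.
Proof.
have [/= E1 E2] := lb.
unshelve eexists (@FrobeniusStructure k C A casimir_cmul l _ _ _ _ _) => //.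
- exact: casimir_cmulA.
- have := congr1 (comp^~ (ruV A)) E2.
  by rewrite -!compA ruVK compm1 /casimir_cmul lmulE wrM -!compA.
- have := congr1 (comp^~ (luV A)) E1.
  by rewrite -!compA luVK compm1 casimir_cmulE wlM -!compA.
- by rewrite -lmulE; exact: lmul_cmul.
- rewrite casimir_cmulE.
  by have := lmul_cmul (A := rev_algebra A) b; rewrite lmulE.
Qed.

End FromDualPair.
End FrobeniusDuality.

Section SymmetricFrobenius.
Variables (k : fieldType) (C : pftcat k).

Lemma symmetric_frobenius_of_pair (A : algebra C) (l : hom A 𝟙) (b : hom 𝟙 (A ⊗ A)) :
  dual_pair (l ∘ amul A) b -> cyclic_pair (l ∘ amul A) (l ∘ amul A) ->
  has_symmetric_frobenius A.
Proof.
move=> /frobenius_of_dual_pair[fr El] lA; exists fr.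
by apply/symmetricP; rewrite El.
Qed.

(** The form on [𝟙] is the unitor, and it is cyclic because of the axiom [piv_unit]. *)
Lemma unit_symmetric_frobenius : has_symmetric_frobenius (unit_algebra C).
Proof.
apply: (symmetric_frobenius_of_pair (A := unit_algebra C) (l := idm 𝟙) (b := luV 𝟙)); rewrite comp1m.
  exact: dual_unitP.
pose h := curry (rd C 𝟙) (lu 𝟙).
have hP : ev (rd C 𝟙) ∘ (h ▹ 𝟙) = lu 𝟙 := curryK _ (rdP C 𝟙).
exists h; split; first by rewrite hP.
have h1 : dual0 C ∘ h = idm 𝟙.
  apply: wr_inj; apply: (iso_mono (is_iso_lu 𝟙)).
  by rewrite wrM compA dual0P hP tmor1 compm1.
by rewrite /evp (piv_unit (pivot C)) ddual0P -compA -wlM h1 tmor1 compm1.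
Qed.

End SymmetricFrobenius.

(** * The right adjoint of a tensor functor *)

Section ImageDual.
Variables (k : fieldType).

Definition image_ev (C D : moncat k) (F : tensor_functor C D) (x y : C)
  (e : hom (y ⊗ x) 𝟙) : hom (F y ⊗ F x) 𝟙 := F0V F ∘ fmap F e ∘ F2 F y x.
Definition image_coev (C D : moncat k) (F : tensor_functor C D) (x y : C)
  (c : hom 𝟙 (x ⊗ y)) : hom 𝟙 (F x ⊗ F y) := F2V F x y ∘ fmap F c ∘ F0 F.

Lemma F2V_natl (C D : moncat k) (F : tensor_functor C D) (x y z : C) (f : hom y z) :
  F2V F x z ∘ fmap F (x ◃ f) = (F x ◃ fmap F f) ∘ F2V F x y.
Proof. by rewrite F2V_nat fmap1. Qed.

Lemma F2V_natr (C D : moncat k) (F : tensor_functor C D) (x y z : C) (f : hom y z) :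
  F2V F z x ∘ fmap F (f ▹ x) = (fmap F f ▹ F x) ∘ F2V F y x.
Proof. by rewrite F2V_nat fmap1. Qed.

Lemma F2_natl (C D : moncat k) (F : laxmon C D) (x y z : C) (f : hom y z) :
  F2 F x z ∘ (F x ◃ fmap F f) = fmap F (x ◃ f) ∘ F2 F x y.
Proof. by rewrite -F2_nat fmap1. Qed.

Lemma F2_natr (C D : moncat k) (F : laxmon C D) (x y z : C) (f : hom y z) :
  F2 F z x ∘ (fmap F f ▹ F x) = fmap F (f ▹ x) ∘ F2 F y x.
Proof. by rewrite -F2_nat fmap1. Qed.

Lemma image_snake (C D : moncat k) (F : tensor_functor C D) (x y : C)
    (e : hom (y ⊗ x) 𝟙) (c : hom 𝟙 (x ⊗ y)) :
  (x ◃ e) ∘ assoc x y x ∘ (c ▹ x) = ruV x ∘ lu x ->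
  (F x ◃ image_ev F e) ∘ assoc (F x) (F y) (F x) ∘ (image_coev F c ▹ F x) =
  ruV (F x) ∘ lu (F x).
Proof.
move=> E; rewrite /image_ev /image_coev !wlM !wrM -!compA.
have A : assoc (F x) (F y) (F x) ∘ (F2V F x y ▹ F x) =
    (F x ◃ F2V F y x) ∘ (F2V F x (y ⊗ x) ∘ (fmap F (assoc x y x) ∘ F2 F (x ⊗ y) x)).
  by rewrite -[LHS]compm1 -(F2K F (x ⊗ y) x) compA F2V_assoc -!compA.
rewrite (compE22 A) -!compA (compE21 (esym (wlM _ (F2 F y x) _))) F2VK tmor1 comp1m.
rewrite -(compE22 (F2V_natl F x e)) (compE22 (F2_natr F x c)).
rewrite !(compE21 (esym (fmapM F _ _))) compA E fmapM -!compA.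
rewrite (compA (fmap F (lu x))) F2_lu !compA; congr (_ ∘ _).
apply: (iso_mono (is_iso_ru (F x))).
by rewrite !compA F2V_ru -fmapM !ruVK fmap1.
Qed.

Lemma image_dual_pair (C D : moncat k) (F : tensor_functor C D) (x y : C)
    (e : hom (y ⊗ x) 𝟙) (c : hom 𝟙 (x ⊗ y)) :
  dual_pair e c -> dual_pair (image_ev F e) (image_coev F c).
Proof.
case=> E1 E2; split; first exact: image_snake.
exact: (image_snake (rev_functor F) E2).
Qed.

End ImageDual.

(** * The action of [C] on the right adjoint *)

Section ModuleStructure.
Variables (k : fieldType) (C D : moncat k) (F : tensor_functor C D) (R : functor D C).
Variable a : adjunction F R.

Definition lact x d : hom (x ⊗ R d) (R (F x ⊗ d)) := locked (ra_lact a x d).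
Local Notation ra := lact.

Lemma lactE x d : lact x d = ra_lact a x d. Proof. by rewrite /lact -lock. Qed.

Lemma lactK x d : acounit a (F x ⊗ d) ∘ fmap F (ra x d) =
  (F x ◃ acounit a d) ∘ F2V F x (R d).
Proof. by rewrite lactE; exact: (transK a). Qed.

Lemma lact_nat x y d d' (f : hom x y) (g : hom d d') :
  ra y d' ∘ (f ⊗₁ fmap R g) = fmap R (fmap F f ⊗₁ g) ∘ ra x d.
Proof.
apply: (transL_inj (a := a)); rewrite transL_fmap /transL fmapM compA !lactK.
by rewrite -!compA F2V_nat !compA -!tmorM acounit_nat comp1m compm1.
Qed.

Lemma lact_natl x d d' (g : hom d d') :
  ra x d' ∘ (x ◃ fmap R g) = fmap R (F x ◃ g) ∘ ra x d.
Proof. by rewrite lact_nat fmap1. Qed.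

Lemma lact_natr x y d (f : hom x y) :
  ra y d ∘ (f ▹ R d) = fmap R (fmap F f ▹ d) ∘ ra x d.
Proof. by rewrite -(fmap1 R) lact_nat. Qed.

Lemma lact_assoc x y d :
  ra x (F y ⊗ d) ∘ (x ◃ ra y d) ∘ assoc x y (R d) =
  fmap R (assoc (F x) (F y) d ∘ (F2V F x y ▹ d)) ∘ ra (x ⊗ y) d.
Proof.
apply: (transL_inj (a := a)); rewrite transL_fmap /transL !fmapM !compA !lactK.
rewrite -(compA (F x ◃ _)) F2V_natl compA -wlM. rewrite lactK wlM -!compA lactK.
rewrite (compA _ (F2V F x (y ⊗ R d))) -F2V_assoc -!compA exchA.
by rewrite (compE22 (assoc_l _ _ _)).
Qed.

Lemma lact_unit d : fmap R (lu d ∘ (F0V F ▹ d)) ∘ ra 𝟙 d = lu (R d).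
Proof.
apply: (transL_inj (a := a)); rewrite transL_fmap /transL lactK -!compA.
by rewrite exchA (compE22 (lu_nat _)) -F2V_lu -!compA.
Qed.

Lemma lact_unitV d : ra 𝟙 d ∘ luV (R d) = fmap R ((F0 F ▹ d) ∘ luV d).
Proof.
have E : ((F0 F ▹ d) ∘ luV d) ∘ (lu d ∘ (F0V F ▹ d)) = idm _.
  by rewrite -!compA (compE20 (luK d)) -wrM (F0P F).2 tmor1.
rewrite -[ra 𝟙 d]comp1m -fmap1 -E fmapM -!compA.
by rewrite (compA _ (ra 𝟙 d)) lact_unit luVK compm1.
Qed.

Section Invertibility.
Variables (x y : C) (e : hom (y ⊗ x) 𝟙) (c : hom 𝟙 (x ⊗ y)).
Hypothesis ec : dual_pair e c.

Lemma cap_lact d :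
  fmap R (cap (image_ev F e) d) ∘ (ra y (F x ⊗ d) ∘ (y ◃ ra x d)) = cap e (R d).
Proof.
have E := lact_assoc y x d.
rewrite -[ra y _ ∘ _]compm1 -(assocVK y x (R d)) (compA (ra y _ ∘ _)) E.
rewrite !capE /image_ev !wrM -!compA.
rewrite !(compE21 (esym (fmapM R _ _))) -!compA assocKA.
rewrite -(wrM d (F2 F y x)) F2VK tmor1 compm1 !fmapM -!compA.
by rewrite -(compE22 (lact_natr _ _)) (compE21 (esym (fmapM R (lu d) _)))
  (compE21 (lact_unit d)).
Qed.

Lemma cup_lact d :
  ra x (F y ⊗ d) ∘ ((x ◃ ra y d) ∘ cup c (R d)) = fmap R (cup (image_coev F c) d).
Proof.
have E := lact_assoc x y d.
rewrite !cupE -!compA (compA (x ◃ _)) (compA (ra _ _)) (compA (ra _ _)) E.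
rewrite -!compA (compE22 (lact_natr _ _)) lact_unitV /image_coev !wrM -!fmapM.
by rewrite -!compA.
Qed.

(** The inverse is the cup of [x], then the action of the dual [y], then [R] of the cap of [F x]. By
    [cap_lact] and [cup_lact] both composites are snakes. *)
Lemma lact_iso d : is_iso (ra x d).
Proof.
exists ((x ◃ (fmap R (cap (image_ev F e) d) ∘ ra y (F x ⊗ d))) ∘ cup c (R (F x ⊗ d))).
split.
- rewrite -compA -cup_nat compA -wlM -compA cap_lact; exact: snake1.
- rewrite wlM -compA (compE22 (lact_natl _ _)) cup_lact -fmapM.
  by rewrite (snake1 (image_dual_pair F ec)) fmap1.
Qed.

End Invertibility.
End ModuleStructure.

(** * Partial traces along [F] and the duality they induce *)

Section LinearCounit.
Variables (k : fieldType) (C D : moncat k) (F : tensor_functor C D) (R : functor D C).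
Variables (a : adjunction F R) (b : adjunction R F).

Definition left_linear_counit : Prop := forall x y,
  acounit b (x ⊗ y) ∘ fmap R (F2 F x y) ∘ ra_lact a x (F y) = x ◃ acounit b y.

Definition right_linear_counit : Prop := forall x y,
  acounit b (x ⊗ y) ∘ fmap R (F2 F x y) ∘ ra_ract a (F x) y = acounit b x ▹ y.

(* A partial trace along [F], [C]-linear in both arguments. *)
Definition ptr x y (f : hom (F x) (F y)) : hom x y :=
  locked (acounit b y ∘ transR a f).

Lemma ptrE x y (f : hom (F x) (F y)) : ptr f = acounit b y ∘ transR a f.
Proof. by rewrite /ptr -lock. Qed.

Lemma ptr_compl x y z (g : hom y z) (f : hom (F x) (F y)) :
  ptr (fmap F g ∘ f) = g ∘ ptr f.
Proof. by rewrite !ptrE transR_comp compA acounit_nat compA. Qed.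

Lemma ptr_compr x y z (f : hom (F y) (F z)) (g : hom x y) :
  ptr (f ∘ fmap F g) = ptr f ∘ g.
Proof. by rewrite !ptrE transR_fmap compA. Qed.

Lemma ptr_unit_counit d : ptr (aunit b d ∘ acounit a d) = idm (R d).
Proof. by rewrite ptrE transR_comp transR_counit compm1 adj_triL. Qed.

Definition ra_pair x y (e : hom (x ⊗ y) 𝟙) : hom (R x ⊗ R y) 𝟙 :=
  ptr (F0 F ∘ e ∘ (acounit a x ⊗₁ acounit a y) ∘ F2V F (R x) (R y)).
Definition ra_copair x y (c : hom 𝟙 (x ⊗ y)) : hom 𝟙 (R x ⊗ R y) :=
  ptr (F2 F (R x) (R y) ∘ (aunit b x ⊗₁ aunit b y) ∘ c ∘ F0V F).

Hypothesis left_linear : left_linear_counit.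

Lemma left_linearE x y :
  acounit b (x ⊗ y) ∘ (fmap R (F2 F x y) ∘ lact a x (F y)) = x ◃ acounit b y.
Proof. by rewrite lactE compA left_linear. Qed.

Lemma ptr_l x y z (f : hom (F y) (F z)) :
  ptr (F2 F x z ∘ (F x ◃ f) ∘ F2V F x y) = x ◃ ptr f.
Proof.
have E : lact a x (F y) ∘ (x ◃ aunit a y) = transR a (F2V F x y).
  apply: (transL_inj (a := a)); rewrite transK transL_comp /transL lactK -compA.
  by rewrite F2V_natl compA -wlM adj_triL tmor1 comp1m.
rewrite !ptrE wlM -left_linearE transR_comp fmapM /transR wlM -/(transR a _).
by rewrite -!compA (compE22 (lact_natl _ _ _)) E.
Qed.

Hypothesis rigidC : forall x : C, exists y (e : hom (y ⊗ x) 𝟙) (c : hom 𝟙 (x ⊗ y)),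
  dual_pair e c.

(* Transposing along [R ⊣ F] and precomposing with [ra_lact] turns both sides
   into [ra_pair e]. *)
Lemma ra_pair_unit x y (e : hom (x ⊗ y) 𝟙) :
  fmap F (ra_pair e) ∘ F2 F (R x) (R y) ∘ (F (R x) ◃ aunit b y) =
  F0 F ∘ e ∘ (acounit a x ▹ y).
Proof.
apply: (transL_inj (a := b)).
have ri : is_iso (lact a (R x) y).
  by have [z [e' [c ec]]] := rigidC (R x); exact: lact_iso ec y.
apply: (iso_epi ri); rewrite /transL !fmapM -!compA (compE22 (acounit_nat _ _)).
rewrite -(lact_natl a) (compA (fmap R (F2 F _ _))) (compA (acounit b _)) left_linearE.
rewrite -wlM adj_triL tmor1 compm1 /ra_pair -!(compA (F0 F)) -!(compA e) ptrE 2!transR_comp.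
do 3!congr (_ ∘ _); rewrite lactE; apply: (transL_inj (a := a)).
by rewrite transL_fmap !transK compA -tmorE.
Qed.

Lemma F2_luV (x : C) : F2 F 𝟙 x ∘ ((F0 F ▹ F x) ∘ luV (F x)) = fmap F (luV x).
Proof.
have fi : is_iso (fmap F (lu x)).
  by exists (fmap F (luV x)); split; rewrite -fmapM ?luK ?luVK fmap1.
by apply: (iso_mono fi); rewrite !compA F2_lu luVK -fmapM luVK fmap1.
Qed.

(** Left linearity makes the whole composite the trace of one map in [D]. There [ra_pair_unit]
    replaces the traced pairing by [e], the snake of [e] and [c] applies, and what remains is the
    trace of [aunit b y ∘ acounit a y], an identity. The other snake is this one for
    [rev_functor F]. *)
Lemma ra_snake x y (e : hom (y ⊗ x) 𝟙) (c : hom 𝟙 (x ⊗ y)) :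
  (e ▹ y) ∘ assocV y x y ∘ (y ◃ c) = luV y ∘ ru y ->
  (ra_pair e ▹ R y) ∘ assocV (R y) (R x) (R y) ∘ (R y ◃ ra_copair c) =
  luV (R y) ∘ ru (R y).
Proof.
move=> E; rewrite /ra_copair -ptr_l -!compA -ptr_compl -ptr_compl.
have N := ra_pair_unit e.
rewrite (wlM _ (F2 F _ _)) -!compA (compA _ (F2 F (R y) _)) (compA (_ ∘ F2 F (R y) _)).
rewrite F2_assocV -!compA -(compE22 (F2_natr F _ (ra_pair e))).
rewrite (wlM _ (_ ⊗₁ _)) -!compA (compE22 (assocV_nat _ _ _)).
rewrite (compE21 (esym (wrM _ (fmap F (ra_pair e)) _))) tmorMA N comp1m.
have -> : (F0 F ∘ e ∘ (acounit a y ▹ x)) ⊗₁ aunit b y =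
    (F0 F ⊗₁ aunit b y) ∘ ((e ▹ y) ∘ ((acounit a y ▹ x) ▹ y)).
  by rewrite -!tmorM !compm1 -!compA.
rewrite -!compA -(compE22 (assocV_r _ _ _)) (compA (acounit a y ▹ _)) exch.
have E' v (h : hom v _) : (e ▹ y) ∘ (assocV y x y ∘ ((y ◃ c) ∘ h)) = luV y ∘ (ru y ∘ h).
  by rewrite !compA E.
rewrite (wlM _ c) -!compA E' -exchA (compE22 (ru_nat _)).
rewrite (compA (ru _)) F2V_ru (compA (F0 F ⊗₁ _)).
have -> : (F0 F ⊗₁ aunit b y) ∘ luV y = (F0 F ▹ F (R y)) ∘ (luV _ ∘ aunit b y).
  by rewrite luV_nat compA -tmorM compm1 comp1m.
rewrite -!compA (compA (F0 F ▹ _)) (compA (F2 F _ _)) F2_luV.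
by rewrite ptr_compl (compA (aunit b y)) ptr_compr ptr_unit_counit comp1m.
Qed.

End LinearCounit.

(** * Pivotal functors *)

Section PivotalFunctor.
Variables (k : fieldType) (C D : pftcat k) (F : tensor_functor C D).

Lemma image_dualP x : is_dual (image_dual F x).
Proof. exact: image_dual_pair (dual_pair_rd x). Qed.

Lemma zetaP x : ev (rd D (F x)) ∘ (zeta F x ▹ F x) = image_ev F (ev (rd C x)).
Proof. by rewrite [LHS](mateP (image_dual F x) _ (rdP D (F x))) tmor1 compm1. Qed.

Hypothesis Fpiv : is_pivotal F.

(** By construction [zeta] matches the right evaluations; pivotality of [F] makes it match the left
    ones too. *)
Lemma evp_zeta x : evp (F x) ∘ (F x ◃ zeta F x) = image_ev F (evp x).
Proof.
rewrite /evp -compA exch compA -dual_morP -compA -wrM Fpiv wrM compA zetaP.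
by rewrite /image_ev fmapM -!compA F2_natr.
Qed.

Variables (R : functor D C) (a : adjunction F R) (b : adjunction R F).
Hypotheses (left_linear : left_linear_counit a b) (right_linear : right_linear_counit a b).

Lemma ptr_r x y z (f : hom (F y) (F z)) :
  ptr a b (F2 F z x ∘ (f ▹ F x) ∘ F2V F y x) = ptr a b f ▹ x.
Proof.
exact: (@ptr_l k (rev C) (rev D) (rev_functor F) R a b
  (fun x y => right_linear y x) x y z f).
Qed.

Lemma ra_dual_pair x y (e : hom (y ⊗ x) 𝟙) (c : hom 𝟙 (x ⊗ y)) :
  dual_pair e c -> dual_pair (ra_pair a b e) (ra_copair a b c).
Proof.
case=> /= E1 E2; split=> /=; last first.
  exact: (ra_snake left_linear (@rigid_right_duals k C) E2).
exact: (@ra_snake k (rev C) (rev D) (rev_functor F) R a b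
  (fun x y => right_linear y x) (@rigid_left_duals k C) y x e c E1).
Qed.

(** The map [g] that rotates [h] into [h'] lifts along [zeta] to [g' : F x -> F (dual y)], and the
    trace of [g'] rotates the traced pairings. Right linearity of the trace serves one pairing, left
    linearity the other. *)
Lemma ptr_cyclic x y (h : hom (F x ⊗ F y) 𝟙) (h' : hom (F y ⊗ F x) 𝟙) :
  cyclic_pair h h' ->
  cyclic_pair (ptr a b (F0 F ∘ h ∘ F2V F x y)) (ptr a b (F0 F ∘ h' ∘ F2V F y x)).
Proof.
case=> g [-> ->]; pose g' := curry (image_dual F y) (ev (rd D (F y)) ∘ (g ▹ F y)).
have Eg : g = zeta F y ∘ g'.
  apply: (ev_inj (rdP D (F y))); rewrite (wrM _ (zeta F y)) compA zetaP.
  exact/esym/(curryK _ (image_dualP y)).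
have IE u v (e : hom (u ⊗ v) 𝟙) : F0 F ∘ image_ev F e = fmap F e ∘ F2 F u v.
  by rewrite /image_ev !compA F0VK comp1m.
exists (ptr a b g'); split.
- rewrite Eg (wrM _ (zeta F y)) (compA (ev _)) zetaP (compA (F0 F)) IE.
  by rewrite -ptr_r -ptr_compl -!compA.
- rewrite Eg (wlM _ (zeta F y)) (compA (evp _)) evp_zeta (compA (F0 F)) IE.
  by rewrite -ptr_l // -ptr_compl -!compA.
Qed.

(** The form on [R A] is the trace of the counit of [A]. Composed with the multiplication of [R A]
    it is the traced form of [A], whose duality and cyclicity are known. *)
Lemma ra_symmetric_frobenius (A : algebra D) :
  has_symmetric_frobenius A -> has_symmetric_frobenius (lax_algebra (ra_laxmon a) A).
Proof.
case=> fr /symmetricP frS.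
have frP := ra_dual_pair (frobenius_dual_pair fr).
have E : (ptr a b (F0 F ∘ cone fr ∘ acounit a A)) ∘ amul (lax_algebra (ra_laxmon a) A) =
  ra_pair a b (cone fr ∘ amul A).
  rewrite /ra_pair /= -ptr_compr; congr (ptr _ _ _).
  by rewrite fmapM -!compA (compE22 (acounit_nat _ _)) ra_F2E.
apply: (symmetric_frobenius_of_pair (A := lax_algebra (ra_laxmon a) A)
  (l := ptr a b (F0 F ∘ cone fr ∘ acounit a A)) (b := ra_copair a b (cmul fr ∘ aone A)));
  rewrite E //.
rewrite /ra_pair -(compA (F0 F)); apply: ptr_cyclic.
exact: cyclic_pair_nat.
Qed.

End PivotalFunctor.

(** * Modules and exactness *)

Section Equivariance.
Variables (k : fieldType) (C : moncat k) (b : C).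
Implicit Types x y z : C.

(* The actions [u] and [v] of [b] need not be associative. For the algebra
   [lax_algebra (ra_laxmon a) A], conversion between bundled modules is too slow, so
   module maps over it are handled in this form. *)
Definition equivariant x y (u : hom (x ⊗ b) x) (v : hom (y ⊗ b) y) (f : hom x y) : Prop :=
  f ∘ u = v ∘ (f ▹ b).

Definition act_on x y (u : hom (y ⊗ b) y) : hom (x ⊗ y ⊗ b) (x ⊗ y) :=
  (x ◃ u) ∘ assoc x y b.

Lemma equivariant_comp x y z (u : hom (x ⊗ b) x) (v : hom (y ⊗ b) y)
    (w : hom (z ⊗ b) z) (g : hom y z) (f : hom x y) :
  equivariant v w g -> equivariant u v f -> equivariant u w (g ∘ f).
Proof. by rewrite /equivariant => Eg Ef; rewrite wrM -compA Ef !compA Eg. Qed.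

Lemma equivariant_inv x y (u : hom (x ⊗ b) x) (v : hom (y ⊗ b) y)
    (f : hom x y) (g : hom y x) :
  is_inverse f g -> equivariant u v f -> equivariant v u g.
Proof.
move=> [gf fg] Ef; rewrite /equivariant -[v]compm1 -tmor1 -fg wrM.
by rewrite (compA v) -Ef !compA gf comp1m.
Qed.

Lemma equivariant_act z x y (u : hom (x ⊗ b) x) (v : hom (y ⊗ b) y) (f : hom x y) :
  equivariant u v f -> equivariant (act_on z u) (act_on z v) (z ◃ f).
Proof.
by rewrite /equivariant /act_on => Ef; rewrite -compA assoc_m !compA -!wlM Ef.
Qed.

Lemma equivariant_assoc x y z (u : hom (z ⊗ b) z) :
  equivariant (act_on (x ⊗ y) u) (act_on x (act_on y u)) (assoc x y z).
Proof.
rewrite /equivariant /act_on (wlM x (y ◃ u)) compA assoc_l -!compA; congr (_ ∘ _).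
by rewrite pentagon -!compA.
Qed.

End Equivariance.

Section RightModuleFacts.
Variables (k : fieldType) (C : moncat k) (A : algebra C).

Definition regular_rmodule : rmodule A :=
  RModule (esym (esym (amulA A))) (amulm1 A).

Lemma is_rmod_mor_comp (M N P : rmodule A) (g : hom N P) (f : hom M N) :
  is_rmod_mor g -> is_rmod_mor f -> is_rmod_mor (M := M) (N := P) (g ∘ f).
Proof. exact: (sok_comp (s := rmod_structured A)). Qed.

Lemma is_rmod_morB (M N : rmodule A) (f g : hom M N) :
  is_rmod_mor f -> is_rmod_mor g -> is_rmod_mor (M := M) (N := N) (f - g).
Proof.
move=> fP gP; rewrite addrC -scaleN1r.
exact: (sok_lin (s := rmod_structured A) M N).2.
Qed.

Lemma amul_rmod_mor : is_rmod_mor (M := act_rmodule A regular_rmodule)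
  (N := regular_rmodule) (amul A).
Proof. by rewrite /is_rmod_mor /= compA amulA. Qed.

Lemma free_rmod_mor x (M : rmodule A) (f : hom (x ⊗ A) M)
    (e := f ∘ (x ◃ aone A) ∘ ruV x) :
  is_rmod_mor (M := act_rmodule x regular_rmodule) f -> f = ract M ∘ (e ▹ A).
Proof.
move=> fP; rewrite /e !wrM -!compA.
rewrite (compA (ract M)) -[ract M ∘ _]fP /= -!compA (compE22 (assoc_m _ _ _)).
by rewrite (compE21 (esym (wlM x _ _))) amul1m (compE21 (triangle _ _)) -wrM ruVK tmor1 compm1.
Qed.

Lemma free_rmod_mor_ext x (M : rmodule A) (g : hom x M) :
  is_rmod_mor (M := act_rmodule x regular_rmodule) (N := M) (ract M ∘ (g ▹ A)).
Proof.
by rewrite /is_rmod_mor /= -!compA exchA -assoc_r (compA (_ ◃ _)) (compA (ract M)) (compA (ract M))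
  -ractA wrM -!compA.
Qed.

End RightModuleFacts.

Section RigidModules.
Variables (k : fieldType) (C : ftcat k) (A : algebra C).

(** The functor [- ⊗ A] preserves cokernels, so the action descends to the cokernel, and the module
    axioms can be tested on epimorphisms. *)
Lemma quotient_rmodule (N M : rmodule A) (f : hom N M) z (c : hom M z) :
  is_rmod_mor f -> is_cokernel f c ->
  exists (Q : rmodule A) (q : hom M Q), is_rmod_mor q /\ is_cokernel f q.
Proof.
move=> fP cP.
have cE := cokernel_epi cP.
have [|r Er] := cokernel_wr (x := A) (f := c ∘ ract M) cP.
  by rewrite -compA -[ract M ∘ _]fP compA cP.1 comp0l.
have rA : r ∘ (r ▹ A) = r ∘ (z ◃ amul A) ∘ assoc z A A.
  apply: (epi_wr (x := A) (epi_wr (x := A) cE)).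
  rewrite -!compA -wrM Er wrM (compA r) Er -compA ractA.
  by rewrite assoc_r -exchA (compA r) Er -!compA.
have r1 : r ∘ (z ◃ aone A) = ru z.
  apply: (epi_wr (x := 𝟙) cE).
  by rewrite -compA -exch compA Er -compA ract1 ru_nat.
by exists (RModule rA r1), c; split=> //; rewrite /is_rmod_mor /= Er.
Qed.

(** The cokernel of [smor f] in [C] carries a module structure, so for an epimorphism of modules the
    projection to it vanishes. *)
Lemma epi_rmodule (M N : structured_cat (rmod_structured A)) (f : hom M N) :
  is_epi f -> is_epi (smor f).
Proof.
move=> fE; have [[_ [_ [_ [coks _]]]] _] := ft_fin C.
have [z [c cP]] := coks _ _ (smor f).
have [Q [q [qP qC]]] := quotient_rmodule (smorP f) cP.
have E : sMk (S := rmod_structured A) (qP : sok (s := rmod_structured A) q) = 0.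
  apply: fE; apply: smor_inj; rewrite !smorM smorK qC.1.
  by rewrite -(comp0l _ (smor f)).
have q0 : q = 0 by rewrite -[q](smorK (qP : sok (s := rmod_structured A) q)) E.
apply: epi_zero => w g gf; have [h [<- _]] := qC.2 _ _ gf.
by rewrite q0 comp0r.
Qed.

(* [M] is then a retract of the free module [M ⊗ A]. *)
Lemma split_action_projective (M : rmodule A) (s : hom M (M ⊗ A)) :
  is_projective (M : C) -> equivariant (ract M) (act_on M (amul A)) s ->
  ract M ∘ s = idm M -> is_projective (M : structured_cat (rmod_structured A)).
Proof.
move=> MP sP sK Y Z q f /epi_rmodule qE.
have [g gE] := MP _ _ _ (smor f) qE.
have gP : equivariant (act_on M (amul A)) (ract (Y : rmodule A))
    (ract (Y : rmodule A) ∘ (g ▹ A)) := free_rmod_mor_ext g.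
have hP := equivariant_comp gP sP.
exists (sMk (hP : sok (s := rmod_structured A) (X := M) (Y := Y) _)).
apply: smor_inj; rewrite smorM smorK !compA.
have -> : smor q ∘ ract (Y : rmodule A) = ract (Z : rmodule A) ∘ (smor q ▹ A) := smorP q.
rewrite -(compA (ract _)) -wrM gE.
have <- : smor f ∘ ract M = ract (Z : rmodule A) ∘ (smor f ▹ A) := smorP f.
by rewrite -compA sK compm1.
Qed.

(** Reassociated, [s] is a section of the action on [p ⊗ N], an object projective in [C] by
    rigidity. *)
Lemma exact_algebra_of_split :
  (forall (p : C) (N : rmodule A), is_projective p ->
    exists2 s : hom (p ⊗ N) (p ⊗ (N ⊗ A)),
      equivariant (act_on p (ract N)) (act_on p (act_on N (amul A))) s &
      (p ◃ ract N) ∘ s = idm (p ⊗ N)) -> is_exact_algebra A.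
Proof.
move=> H p N pP; have [s sP sK] := H p N pP.
have vP := equivariant_inv (assocP p N A) (equivariant_assoc p N (amul A)).
apply: (split_action_projective (M := act_rmodule p N) (s := assocV p N A ∘ s)).
- exact: projective_tensor.
- exact: equivariant_comp vP sP.
- by rewrite /= -!compA (compE20 (assocVK _ _ _)) sK.
Qed.

End RigidModules.

Section AdjointModules.
Variables (k : fieldType) (C D : moncat k) (F : tensor_functor C D) (R : functor D C).
Variable a : adjunction F R.

Lemma ra_F2_lact x y : ra_F2 a x y = fmap R (acounit a x ▹ y) ∘ lact a (R x) y.
Proof.
rewrite lactE; apply: (transL_inj (a := a)).
by rewrite transL_fmap !transK compA -tmorE.
Qed.

Lemma ra_F2_transR c x y (e : hom (F c) x) :
  ra_F2 a x y ∘ (transR a e ▹ R y) =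
  transR a ((e ▹ y) ∘ ((F c ◃ acounit a y) ∘ F2V F c (R y))).
Proof.
apply: (transL_inj (a := a)); rewrite transK transL_comp.
have -> : transL a (ra_F2 a x y) = _ := ra_F2E a x y.
rewrite -compA F2V_natr tmorMA compm1.
have -> : acounit a x ∘ fmap F (transR a e) = e := transK a e.
by rewrite (tmorE e) -compA.
Qed.

Definition ra_act x y (u : hom (x ⊗ y) x) : hom (R x ⊗ R y) (R x) := fmap R u ∘ ra_F2 a x y.

Lemma ra_equivariant x y b (u : hom (x ⊗ b) x) (v : hom (y ⊗ b) y) (f : hom x y) :
  equivariant u v f -> equivariant (ra_act u) (ra_act v) (fmap R f).
Proof.
rewrite /equivariant /ra_act => Ef; rewrite compA -fmapM Ef fmapM -!(compA (fmap R v)).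
by have := F2_natr (ra_laxmon a) b f => /= ->.
Qed.

(** Makes [lact] a map of modules over [R A]; in particular the free module [N ⊗ R A] is [R] of the
    free module [F N ⊗ A]. *)
Lemma lact_equivariant x (A M : D) (u : hom (M ⊗ A) M) :
  equivariant (act_on x (ra_act u)) (ra_act (act_on (F x) u)) (lact a x M).
Proof.
rewrite /equivariant /act_on /ra_act (wlM x (fmap R _)) -(compA (x ◃ _)) (compE22 (lact_natl _ _ _)).
rewrite (fmapM R (F x ◃ _)) -2!(compA (fmap R (F x ◃ _))); congr (_ ∘ _).
rewrite -(compA (fmap R _)); apply: (transL_inj (a := a)); rewrite transL_fmap.
rewrite (transL_comp a (lact _ _ _)) (transL_comp a (ra_F2 a _ _)) (fmapM F (x ◃ _)).
have -> : transL a (lact a x (M ⊗ A)) = (F x ◃ acounit a _) ∘ F2V F x _ := lactK a x _.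
have -> : transL a (ra_F2 a (F x ⊗ M) A) = _ := ra_F2E a _ _.
rewrite -!compA (compE22 (F2V_natl _ _ _)) (compE21 (esym (wlM (F x) _ _))) ra_F2E wlM.
rewrite -!compA (compA (F x ◃ F2V F _ _)) -F2V_assoc -!compA.
rewrite F2V_natr tmorMA lactK tmorM -!compA.
by rewrite (compE22 (assoc_nat _ _ _)).
Qed.

End AdjointModules.

(** * Exactness of the image of an exact algebra *)

Section Exactness.
Variables (k : fieldType) (C D : ftcat k) (F : tensor_functor C D) (R : functor D C).
Variables (a : adjunction F R) (b : adjunction R F) (A : algebra D).
Local Notation G := (ra_laxmon a).
Local Notation B := (lax_algebra G A).
Local Notation SA := (rmod_structured A).

Lemma ra_lact_iso x d : is_iso (lact a x d).
Proof. exact: lact_iso (dual_pair_rd x) d. Qed.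

Lemma functor_projective p : is_projective p -> is_projective (F p).
Proof.
by apply: (left_adjoint_projective a) => x y f; exact: (left_adjoint_epi b).
Qed.

Variable N : rmodule B.
Local Notation FN := (F N).

(** In the parallel pair defining F N ⊗_{F B} A, [act_map] lets [F B] act on [F N], and [counit_map]
    lets it act on [A] through the counit [F (R A) -> A]. *)
Definition act_map : hom (F (N ⊗ B) ⊗ A) (FN ⊗ A) := fmap F (ract N) ▹ A.
Definition counit_map : hom (F (N ⊗ B) ⊗ A) (FN ⊗ A) :=
  (FN ◃ amul A) ∘ (assoc FN A A ∘ (((FN ◃ acounit a A) ∘ F2V F N B) ▹ A)).

Lemma act_map_mor : is_rmod_mor (M := act_rmodule (F (N ⊗ B)) (regular_rmodule A))
  (N := act_rmodule FN (regular_rmodule A)) act_map.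
Proof. exact: act_rmod_mor (sok_id (s := SA) _). Qed.

Lemma counit_map_mor : is_rmod_mor (M := act_rmodule (F (N ⊗ B)) (regular_rmodule A))
  (N := act_rmodule FN (regular_rmodule A)) counit_map.
Proof.
apply: (is_rmod_mor_comp (N := act_rmodule FN (act_rmodule A (regular_rmodule A)))).
  exact: (act_rmod_mor (M := act_rmodule A (regular_rmodule A)) _ (@amul_rmod_mor _ _ A)).
apply: (is_rmod_mor_comp (N := act_rmodule (FN ⊗ A) (regular_rmodule A))).
  exact: assoc_rmod_mor.
exact: act_rmod_mor (sok_id (s := SA) _).
Qed.

(** Along [lact], the functor [R] turns the pair into acting on [N] and multiplying in [B], two maps
    [N ⊗ B ⊗ B -> N ⊗ B]; the action of [N] equalizes their composites by [ractA]. *)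
Lemma coeq_relation r : is_inverse (lact a N A) r ->
  ract N ∘ r ∘ fmap R (act_map - counit_map) = 0.
Proof.
move=> [r1 r2]; rewrite fmapB compBr; apply/eqP; rewrite subr_eq0; apply/eqP.
apply: (iso_epi (ra_lact_iso (N ⊗ B) A)).
rewrite /act_map -!compA -lact_natr (compE20 r1).
have E : fmap R counit_map ∘ lact a (N ⊗ B) A = lact a N A ∘ ((N ◃ amul B) ∘ assoc N B B).
  rewrite /= (wlM N (fmap R _)) ra_F2_lact (wlM N (fmap R _)) -!compA.
  rewrite !(compE22 (lact_natl _ _ _)) (compA (lact a N _)) lact_assoc !compA -!fmapM.
  congr (fmap R _ ∘ _); rewrite /counit_map wrM -!compA; congr (_ ∘ _).
  by rewrite -(compE22 (assoc_m _ _ _)).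
by rewrite E (compE20 r1) compA ractA.
Qed.

Section Coequalizer.
Variables (Q : rmodule A) (q : hom (FN ⊗ A) Q).
Hypothesis qP : is_rmod_mor (M := act_rmodule FN (regular_rmodule A)) q.
Hypothesis q12 : q ∘ act_map = q ∘ counit_map.

Definition coeq_incl : hom FN Q := q ∘ (FN ◃ aone A) ∘ ruV FN.

Lemma coeq_inclE : q = ract Q ∘ (coeq_incl ▹ A).
Proof. exact: free_rmod_mor qP. Qed.

(** The relation n b ⊗ 1 = n ⊗ b of a tensor product over [F B]; it makes the transpose of
    [coeq_incl] a map of [B]-modules. *)
Lemma coeq_incl_act :
  coeq_incl ∘ fmap F (ract N) = q ∘ ((FN ◃ acounit a A) ∘ F2V F N B).
Proof.
set g := _ ∘ F2V F N B.
rewrite /coeq_incl -!compA ruV_nat -(compE22 (exch _ _)) (compE22 q12) /counit_map -/g.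
congr (_ ∘ _); rewrite -!compA (compE22 (exch _ _)) -ruV_nat (compE22 (assoc_l _ _ _)).
by rewrite (compE21 (esym (wlM FN _ _))) amulm1 (compE21 (ruA _ _)) (compE20 (ruVK _)).
Qed.

Lemma coeq_incl_mor : equivariant (ract N) (ra_act a (ract Q)) (transR a coeq_incl).
Proof.
have E : transR a coeq_incl ∘ ract N =
    fmap R (ract Q) ∘ (ra_F2 a Q A ∘ (transR a coeq_incl ▹ R A)).
  by rewrite ra_F2_transR -transR_comp -transR_fmap coeq_incl_act {1}coeq_inclE -compA.
exact: etrans E (compA _ _ _).
Qed.

(** Expresses the transpose through n ↦ n ⊗ 1 in [N ⊗ B], so that a map inducing the action of [N]
    sends it to n 1 = n. *)
Lemma transR_coeq_incl :
  transR a coeq_incl = fmap R q ∘ (lact a N A ∘ ((N ◃ aone B) ∘ ruV N)).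
Proof.
apply: (transL_inj (a := a)); rewrite transK transL_fmap (transL_comp a (lact _ _ _)).
have -> : transL a (lact a N A) = _ := lactK a N A.
rewrite /coeq_incl -!compA; congr (_ ∘ _).
rewrite fmapM (compE22 (F2V_natl _ _ _)) (compE21 (esym (wlM FN _ _))).
rewrite /= (fmapM F (fmap R (aone A))) (compA (acounit a A)) acounit_nat -compA (ra_F0E a).
rewrite wlM -!compA; congr (_ ∘ _).
by apply: (iso_mono (is_iso_ru FN)); rewrite !compA F2V_ru -fmapM ruVK ruVK fmap1.
Qed.

End Coequalizer.

(* [N] is a retract of [R Q] for the [A]-module [Q], the coequalizer of
   [act_map] and [counit_map], i.e. [F N] tensored with [A] over [F (R A)]. *)
Lemma module_retract : exists (Q : rmodule A) (q : hom (FN ⊗ A) Q) (j : hom N (R Q))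
    (h : hom (R Q) N),
  [/\ is_rmod_mor (M := act_rmodule FN (regular_rmodule A)) q, is_epi q,
      equivariant (ract N) (ra_act a (ract Q)) j, h ∘ j = idm N
    & h ∘ fmap R q ∘ lact a N A = ract N].
Proof.
have [[_ [_ [_ [coks _]]]] _] := ft_fin D.
have [z [c cP]] := coks _ _ (act_map - counit_map).
have [Q [q [qP qC]]] := quotient_rmodule (is_rmod_morB act_map_mor counit_map_mor) cP.
have [r rP] := ra_lact_iso N A.
(* As a left adjoint of [F], [R] preserves the cokernel [q], so the action of [N] factors through
   [R Q]. *)
have [h hP] := left_adjoint_cokernel b qC (coeq_relation rP).
have q12 : q ∘ act_map = q ∘ counit_map.
  by apply/eqP; rewrite -subr_eq0 -compBr qC.1.
exists Q, q, (transR a (coeq_incl q)), h; split; first exact: qP.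
- exact: cokernel_epi qC.
- exact: coeq_incl_mor.
- rewrite transR_coeq_incl (compA h) hP -!compA (compE20 rP.1) (compE21 (ract1 _)).
  exact: ruVK.
- by rewrite hP -compA rP.1 compm1.
Qed.

Lemma exact_algebra_section p (M Q : rmodule A) (q : hom M Q) :
  is_exact_algebra A -> is_projective p -> is_rmod_mor q -> is_epi q ->
  exists2 s : hom (F p ⊗ Q) (F p ⊗ M),
    equivariant (act_on (F p) (ract Q)) (act_on (F p) (ract M)) s &
    (F p ◃ q) ∘ s = idm (F p ⊗ Q).
Proof.
move=> AP pP qP qE.
pose pi : hom (act_rmodule (F p) M : rmod_cat A) (act_rmodule (F p) Q) :=
  sMk (act_rmod_mor (idm (F p)) qP : sok (s := SA) _).
have piE : is_epi pi.
  move=> z g g' E; apply: smor_inj; apply: (epi_wl (x := F p) qE).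
  exact: (congr1 (@smor _ _ _ _ _) E).
have [s sE] := AP (F p) Q (functor_projective pP) _ _ pi (idm _) piE.
exists (smor s); first exact: (smorP s).
exact: (congr1 (@smor _ _ _ _ _) sE).
Qed.

(* The action [p ⊗ (N ⊗ B) -> p ⊗ N] splits: the [A]-linear epimorphism
   [F p ⊗ (F N ⊗ A) -> F p ⊗ Q] does since [F p ⊗ Q] is projective. *)
Lemma action_split p : is_exact_algebra A -> is_projective p ->
  exists2 s : hom (p ⊗ N) (p ⊗ (N ⊗ B)),
    equivariant (act_on p (ract N)) (act_on p (act_on N (ra_act a (amul A)))) s &
    (p ◃ ract N) ∘ s = idm (p ⊗ N).
Proof.
move=> AP pP; have [Q [q [j [h [qP qE jP hj hq]]]]] := module_retract.
pose M := act_rmodule FN (regular_rmodule A).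
have [s sP sE] := exact_algebra_section (M := M) AP pP qP qE.
pose f := lact a p (FN ⊗ A) ∘ (p ◃ lact a N A).
have [g gP] : is_iso f.
  apply: is_iso_comp (ra_lact_iso _ _) _.
  exact: is_iso_tmor (is_iso_id _) (ra_lact_iso _ _).
have [l lP] := ra_lact_iso p Q.
have fP : equivariant (act_on p (act_on N (ra_act a (amul A))))
    (ra_act a (act_on (F p) (act_on FN (amul A)))) f.
  apply: equivariant_comp (lact_equivariant a p (act_on FN (amul A))) _.
  exact: equivariant_act (lact_equivariant a N (amul A)).
have gM := equivariant_inv gP fP.
(* The section is the composite p ⊗ N → p ⊗ R Q ≅ R (F p ⊗ Q) → R (F p ⊗ M) ≅ p ⊗ (N ⊗ B). *)
exists (g ∘ (fmap R s ∘ (lact a p Q ∘ (p ◃ j)))).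
- apply: equivariant_comp gM _.
  apply: equivariant_comp (ra_equivariant a sP) _.
  apply: equivariant_comp (lact_equivariant a p (ract Q)) _.
  exact: equivariant_act jP.
- have E : (p ◃ fmap R q) ∘ ((p ◃ lact a N A) ∘ g) = l ∘ fmap R (F p ◃ q).
    have E' := gP.2; rewrite /f -compA in E'.
    rewrite -[LHS]comp1m -lP.1 -compA (compE22 (lact_natl _ _ _)).
    by rewrite E' compm1.
  rewrite -hq !wlM -!compA (compA (p ◃ lact a N A)) (compA (p ◃ fmap R q)) E.
  rewrite -!compA (compE21 (esym (fmapM R _ _))) sE fmap1 comp1m (compE20 lP.1).
  by rewrite -wlM hj tmor1.
Qed.

End Exactness.

Lemma ra_exact_algebra (k : fieldType) (C D : ftcat k) (F : tensor_functor C D)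
    (R : functor D C) (a : adjunction F R) (b : adjunction R F) (A : algebra D) :
  is_exact_algebra A -> is_exact_algebra (lax_algebra (ra_laxmon a) A).
Proof.
by move=> AP; apply: exact_algebra_of_split => p N; exact: action_split.
Qed.

(** * Linear counits *)

Section BimoduleIso.
Variables (k : fieldType) (C D : moncat k) (F : tensor_functor C D).
Variables (L R : functor D C) (al : adjunction L F) (ar : adjunction F R).
Variables (t : forall d, hom (L d) (R d)) (t_iso : is_natural_iso t).
Local Notation b := (iso_adjunction al t_iso).

Lemma la_lact_counit x y :
  (x ◃ acounit al y) ∘ la_lact al x (F y) = acounit al (x ⊗ y) ∘ fmap L (F2 F x y).
Proof.
rewrite /la_lact -transL_fmap; congr (transL _ _).
by rewrite compA -F2_natl -compA -wlM adj_triR tmor1 compm1.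
Qed.

Hypothesis rigidC : forall x : C, exists y (e : hom (y ⊗ x) 𝟙) (c : hom 𝟙 (x ⊗ y)),
  dual_pair e c.
Hypothesis t_left : forall c d, ra_lact ar c d ∘ (c ◃ t d) ∘ la_lact al c d = t (F c ⊗ d).

(** The counit of [al] is linear for [la_lact], and [t] carries [la_lact] to the inverse of
    [ra_lact]. Precomposing with the isomorphism [w] compares the two. *)
Lemma tfrobenius_left_linear : left_linear_counit ar b.
Proof.
move=> x y; rewrite -lactE; pose w := (x ◃ t (F y)) ∘ la_lact al x (F y).
have tw : lact ar x (F y) ∘ w = t (F x ⊗ F y) by rewrite lactE compA t_left.
have [l lP] : is_iso (lact ar x (F y)).
  by have [z [e [c ec]]] := rigidC x; exact: lact_iso ec (F y).
have wi : is_iso w.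
  have -> : w = l ∘ t (F x ⊗ F y) by rewrite -tw compA lP.1 comp1m.
  by apply: is_iso_comp (t_iso.2 _); exists (lact ar x (F y)); case: lP.
have bE z : acounit b z = acounit al z ∘ iso_inv t_iso (F z) by [].
apply: (iso_epi wi); rewrite !bE -!compA tw (compE22 (iso_inv_nat t_iso _)).
rewrite (iso_invP t_iso _).1 compm1 -la_lact_counit /w (wlM x (acounit al y)) -!compA.
by rewrite (compE21 (esym (wlM x (iso_inv t_iso _) _))) (iso_invP t_iso _).1 tmor1 comp1m.
Qed.

End BimoduleIso.

Lemma tfrobenius_linear (k : fieldType) (C D : ftcat k) (F : tensor_functor C D)
    (L R : functor D C) (al : adjunction L F) (ar : adjunction F R) :
  is_tfrobenius al ar ->
  exists b : adjunction R F, left_linear_counit ar b /\ right_linear_counit ar b.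
Proof.
case=> t [ti tl tr]; exists (iso_adjunction al ti); split.
  exact: tfrobenius_left_linear (@rigid_right_duals k C) tl.
move=> x y; exact: (@tfrobenius_left_linear k (rev C) (rev D) (rev_functor F) L R al ar t ti
  (@rigid_left_duals k C) (fun c d => tr d c) y x).
Qed.

(* The counit [acounit b 𝟙 : R (F 𝟙) -> 𝟙] alone determines a left [C]-linear
   transformation [R F c ≅ c ⊗ R (F 𝟙) -> c]; rigidity makes it the counit of an
   adjunction again. *)
Section LeftLinearization.
Variables (k : fieldType) (C D : ftcat k) (F : tensor_functor C D) (R : functor D C).
Variables (a : adjunction F R) (b : adjunction R F).

Definition free_iso c : hom (c ⊗ R (F 𝟙)) (R (F c)) :=
  locked (fmap R (fmap F (ru c) ∘ F2 F c 𝟙) ∘ lact a c (F 𝟙)).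

Lemma free_isoE c : free_iso c = fmap R (fmap F (ru c) ∘ F2 F c 𝟙) ∘ lact a c (F 𝟙).
Proof. by rewrite /free_iso -lock. Qed.

Lemma is_iso_fmap (X Y : lincat k) (G : functor X Y) x y (f : hom x y) :
  is_iso f -> is_iso (fmap G f).
Proof.
by case=> g [gf fg]; exists (fmap G g); split; rewrite -fmapM ?gf ?fg fmap1.
Qed.

Lemma free_iso_iso c : is_iso (free_iso c).
Proof.
rewrite free_isoE; apply: is_iso_comp (ra_lact_iso a c _).
apply: is_iso_fmap; apply: is_iso_comp (is_iso_F2 F _ _).
exact: is_iso_fmap (is_iso_ru c).
Qed.

Lemma free_iso_nat c d (f : hom c d) :
  fmap R (fmap F f) ∘ free_iso c = free_iso d ∘ (f ▹ R (F 𝟙)).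
Proof.
rewrite !free_isoE -!compA lact_natr (compE21 (esym (fmapM R _ _))).
rewrite (compE21 (esym (fmapM R _ _))); congr (fmap R _ ∘ _).
by rewrite -!compA F2_natr (compA _ (fmap F (f ▹ 𝟙))) -fmapM ru_nat fmapM -compA.
Qed.

Lemma free_iso_unit : free_iso 𝟙 = lu (R (F 𝟙)).
Proof.
rewrite free_isoE -[lact a 𝟙 _]compm1 -(luK (R (F 𝟙))) (compA (lact a _ _)) lact_unitV.
rewrite compA -fmapM -!compA -lu_unit (compA (F2 F _ _)) compA (compA (fmap F _)) F2_lu.
by rewrite luVK fmap1 comp1m.
Qed.

Lemma free_iso_tensor x y : fmap R (F2 F x y) ∘ (lact a x (F y) ∘ (x ◃ free_iso y)) =
  free_iso (x ⊗ y) ∘ assocV x y (R (F 𝟙)).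
Proof.
have E := lact_assoc a x y (F 𝟙).
apply: (iso_epi (is_iso_assoc x y (R (F 𝟙)))).
rewrite -[RHS]compA assocK compm1 !free_isoE (wlM x (fmap R _)) -!compA.
rewrite (compE22 (lact_natl _ _ _)) (compA (lact a x _)) E !compA -!fmapM.
congr (fmap R _ ∘ _); rewrite (wlM (F x) (fmap F _)) -!compA.
rewrite (compE22 (F2_natl F _ _)) (compA (F2 F x _)) (compA (_ ∘ _) (assoc _ _ _)).
rewrite -F2_assoc -!compA -wrM F2VK tmor1 compm1 compA -fmapM.
by rewrite ruA.
Qed.

Definition free_iso_inv c : hom (R (F c)) (c ⊗ R (F 𝟙)) := sval (cid (free_iso_iso c)).

Lemma free_iso_invP c : is_inverse (free_iso c) (free_iso_inv c).
Proof. exact: svalP (cid (free_iso_iso c)). Qed.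

Definition lin_counit c : hom (R (F c)) c :=
  locked (ru c ∘ ((c ◃ acounit b 𝟙) ∘ free_iso_inv c)).

Lemma lin_counitE c : lin_counit c ∘ free_iso c = ru c ∘ (c ◃ acounit b 𝟙).
Proof. by rewrite /lin_counit -lock -!compA (free_iso_invP c).1 compm1. Qed.

Lemma lin_counit_nat c d (f : hom c d) : lin_counit d ∘ fmap R (fmap F f) = f ∘ lin_counit c.
Proof.
apply: (iso_epi (free_iso_iso c)); rewrite -!compA free_iso_nat lin_counitE.
by rewrite compA lin_counitE -!compA -exch compA ru_nat -!compA.
Qed.

Lemma lin_counit_unit : lin_counit 𝟙 = acounit b 𝟙.
Proof.
apply: (iso_epi (free_iso_iso 𝟙)).
by rewrite lin_counitE free_iso_unit -lu_unit lu_nat.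
Qed.

Lemma lin_counit_left x y :
  lin_counit (x ⊗ y) ∘ (fmap R (F2 F x y) ∘ lact a x (F y)) = x ◃ lin_counit y.
Proof.
apply: (iso_epi (is_iso_tmor (is_iso_id x) (free_iso_iso y))).
rewrite -!compA free_iso_tensor -wlM lin_counitE (compA (lin_counit _)) lin_counitE.
by rewrite -!compA -assocV_l compA ruAV wlM.
Qed.

(** Pairing with the dual of [c] moves everything to the component at [𝟙], where [lin_counit] is the
    counit of [b]. Both the injectivity of transposition and the existence of a unit are thereby
    inherited from [b]. *)
Lemma lin_counit_dual d c (f : hom d (F c)) :
  ev (rd C c) ∘ (dual c ◃ (lin_counit c ∘ fmap R f)) =
  acounit b 𝟙 ∘ fmap R (F0 F ∘ (image_ev F (ev (rd C c)) ∘ (F (dual c) ◃ f))) ∘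
    lact a (dual c) d.
Proof.
rewrite (wlM _ (lin_counit c)) -lin_counit_left -!compA (lact_natl a).
rewrite (compA (ev _)) -lin_counit_nat lin_counit_unit -!compA !(compE21 (esym (fmapM R _ _))).
congr (_ ∘ (fmap R _ ∘ _)).
by rewrite /image_ev -!compA (compE20 (F0VK F)).
Qed.

Lemma lin_counit_inj d c (f g : hom d (F c)) :
  lin_counit c ∘ fmap R f = lin_counit c ∘ fmap R g -> f = g.
Proof.
move=> E; apply: (ev_injl (image_dual_pair F (dual_pair_rd c))) => /=.
apply: (iso_mono (f := F0 F)); first by exists (F0V F); exact: F0P.
apply: (transL_inj (a := b)); apply: (iso_epi (ra_lact_iso a (dual c) d)).
by rewrite /transL -!lin_counit_dual E.
Qed.

Lemma lin_unit_exists d : exists f : hom d (F (R d)), lin_counit (R d) ∘ fmap R f = idm (R d).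
Proof.
have [l lP] := ra_lact_iso a (dual (R d)) d.
pose h := transR b (ev (rd C (R d)) ∘ l).
have dP := image_dual_pair F (dual_pair_rd (R d)).
have [f fE] := curryl (d := DualData _ _) (F0V F ∘ h) dP.
exists f; apply: (ev_injl (rdP C (R d))); rewrite lin_counit_dual.
rewrite [image_ev _ _ ∘ _]fE compA F0VK comp1m [acounit b _ ∘ _](transK b).
by rewrite -compA lP.1 tmor1.
Qed.

Definition lin_adjunction : adjunction R F :=
  counit_adjunction lin_counit_nat (fun d => svalP (cid (lin_unit_exists d))) lin_counit_inj.

Lemma lin_adjunction_left : left_linear_counit a lin_adjunction.
Proof. by move=> x y; rewrite -lactE -compA; exact: lin_counit_left. Qed.

End LeftLinearization.

(** * Half-braidings and central functors *)

Lemma hb_unit (k : fieldType) (D : moncat k) (X : half_braided D) :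
  hb X 𝟙 = luV X ∘ ru X.
Proof.
(* Up to unitors this says that the half-braiding at [𝟙] is idempotent; being invertible, it is
   trivial. *)
have E := hb_tensor X 𝟙 𝟙.
have hi : is_iso (lu X ∘ hb X 𝟙) := is_iso_comp (is_iso_lu X) (hb_iso X 𝟙).
suff : lu X ∘ hb X 𝟙 = ru X.
  by move=> <-; rewrite compA luK comp1m.
apply: wr_inj; apply: (iso_mono hi).
have := congr1 (fun f => lu X ∘ ((𝟙 ◃ lu X) ∘ f)) E; rewrite /= => E'.
have lhs : lu X ∘ ((𝟙 ◃ lu X) ∘ (assoc 𝟙 𝟙 X ∘ hb X (𝟙 ⊗ 𝟙) ∘ assoc X 𝟙 𝟙)) =
    lu X ∘ hb X 𝟙 ∘ (ru X ▹ 𝟙).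
  rewrite -!compA (compE21 (triangle _ _)) -lu_unit -(hb_natA (X := X) (lu 𝟙)) triangle.
  by [].
have rhs : lu X ∘ ((𝟙 ◃ lu X) ∘ ((𝟙 ◃ hb X 𝟙) ∘ assoc 𝟙 X 𝟙 ∘ (hb X 𝟙 ▹ 𝟙))) =
    lu X ∘ hb X 𝟙 ∘ ((lu X ∘ hb X 𝟙) ▹ 𝟙).
  rewrite -!compA (compE21 (esym (wlM _ (lu X) _))) (compE22 (lu_nat _)).
  by rewrite (compE21 (luA _ _)) -wrM -!compA.
by rewrite -lhs -rhs E'.
Qed.

Section CentralFunctor.
Variables (k : fieldType) (C D : moncat k) (br : braiding C) (F : tensor_functor C D).
Variable cs : central_structure br F.
Local Notation cmp := (lift_cmp cs).

Lemma cmp_iso c : is_iso (cmp c).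
Proof. by case: (lift_cmp_iso cs) => [[_ H] _ _]; exact: H. Qed.

Definition cmpV c : hom (hbcar (cs c)) (F c) := sval (cid (cmp_iso c)).

Lemma cmpP c : is_inverse (cmp c) (cmpV c).
Proof. exact: svalP (cid (cmp_iso c)). Qed.

Definition central_hb c d : hom (F c ⊗ d) (d ⊗ F c) :=
  locked ((d ◃ cmpV c) ∘ (hb (cs c) d ∘ (cmp c ▹ d))).

Lemma central_hbE c d : (d ◃ cmp c) ∘ central_hb c d = hb (cs c) d ∘ (cmp c ▹ d).
Proof. by rewrite /central_hb -lock compA -wlM (cmpP c).2 tmor1 comp1m. Qed.

Lemma cmp_wl_mono c d : is_mono (d ◃ cmp c).
Proof. exact: iso_mono (is_iso_tmor (is_iso_id d) (cmp_iso c)). Qed.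

Lemma central_hb_nat c d d' (f : hom d d') :
  central_hb c d' ∘ (F c ◃ f) = (f ▹ F c) ∘ central_hb c d.
Proof.
apply: cmp_wl_mono; rewrite !compA -exch central_hbE -!compA central_hbE exch.
by rewrite !compA hb_nat.
Qed.

Lemma central_hb_unit c : central_hb c 𝟙 = luV (F c) ∘ ru (F c).
Proof.
apply: cmp_wl_mono; rewrite central_hbE hb_unit -compA ru_nat !compA.
by rewrite luV_nat.
Qed.

(** The lift sends the braiding of [C] to the half-braiding in the center, and [cmp] carries this
    equation back to [F]. *)
Lemma central_hb_braid x y :
  fmap F (br x y) ∘ F2 F x y = F2 F y x ∘ central_hb x (F y).
Proof.
have [[cn _] cm _] := lift_cmp_iso cs.
pose f : hom (hbcar (cs (x ⊗ y))) (hbcar (cs (y ⊗ x))) := smor (fmap (lift cs) (br x y)).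
pose g u v : hom (hbcar (cs u) ⊗ hbcar (cs v)) (hbcar (cs (u ⊗ v))) := smor (F2 (lift cs) u v).
have E : f ∘ g x y = g y x ∘ hb (cs x) (cs y) :=
  congr1 (@smor _ _ _ _ _) (lift_braided cs x y).
have Ec : cmp (y ⊗ x) ∘ fmap F (br x y) = f ∘ cmp (x ⊗ y) := cn _ _ (br x y).
have Eg u v : cmp (u ⊗ v) ∘ F2 F u v = g u v ∘ (cmp u ⊗₁ cmp v).
  exact: etrans (cm u v) (congr1 (comp^~ _) (compm1 _)).
move: f g E Ec Eg => f g E Ec Eg.
apply: (iso_mono (cmp_iso (y ⊗ x))).
rewrite (compA (cmp _) (fmap F _)) Ec -(compA f) Eg (compA f) E (compA (cmp _)) Eg.
rewrite -(compA (g y x)) -(compA (g y x)); congr (_ ∘ _).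
rewrite (tmorE' (cmp x)) (compA (hb _ _)) hb_nat -(compA (_ ▹ _)) -central_hbE.
by rewrite (compA (_ ▹ _)) -tmorE.
Qed.

Lemma central_hb_F2V x y :
  F2V F y x ∘ fmap F (br x y) = central_hb x (F y) ∘ F2V F x y.
Proof.
apply: (iso_mono (is_iso_F2 F y x)); apply: (iso_epi (is_iso_F2 F x y)).
by rewrite (compE20 (F2VK F _ _)) central_hb_braid -!compA F2K compm1.
Qed.

Lemma lact_central (R : functor D C) (a : adjunction F R) c d :
  fmap R (central_hb c d) ∘ lact a c d = ra_ract a d c ∘ br c (R d).
Proof.
apply: (transL_inj (a := a)); rewrite transL_fmap (transL_comp a (ra_ract _ _ _)).
have -> : transL a (ra_ract a d c) = (acounit a d ▹ F c) ∘ F2V F (R d) c := transK a _.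
have -> : transL a (lact a c d) = _ := lactK a c d.
rewrite compA central_hb_nat -!compA; congr (_ ∘ _).
exact/esym/central_hb_F2V.
Qed.

(** By [lact_central] the braiding turns the right action on [R] into the left one; naturality of
    the counit and of the braiding then moves the braiding through the equation. *)
Lemma central_right_linear (R : functor D C) (a : adjunction F R) (b : adjunction R F) :
  left_linear_counit a b -> right_linear_counit a b.
Proof.
move=> bl x y; apply: (iso_epi (br_iso br y (R (F x)))).
rewrite -(compA (_ ∘ _)) -lact_central compA -(compA (acounit b _)) -fmapM.
rewrite -central_hb_braid fmapM (compA (acounit b _)) acounit_nat -!(compA (br y x)).
by rewrite -(compA (acounit b _)) (left_linearE bl) br_nat.
Qed.

(** After transposition the braiding becomes [central_hb], and naturality along the counit
    [F (R 𝟙) -> 𝟙] moves it to the unit object, where it is trivial. *)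
Lemma ra_commutative (R : functor D C) (a : adjunction F R) :
  is_commutative br (lax_algebra (ra_laxmon a) (unit_algebra D)).
Proof.
rewrite /is_commutative /=.
rewrite -(compA (fmap R _)); apply: (transL_inj (a := a)).
rewrite !(transL_fmap a (lu 𝟙)) (transL_comp a (ra_F2 a _ _)).
have -> : transL a (ra_F2 a 𝟙 𝟙) = _ := ra_F2E a _ _.
rewrite -(compA (_ ⊗₁ _)) central_hb_F2V (compA (_ ⊗₁ _)) !(compA (lu 𝟙)).
congr (_ ∘ _); rewrite [in LHS]tmorE' -!compA -central_hb_nat central_hb_unit.
rewrite -!compA (compE22 (lu_nat _)) (compE20 (luVK _)).
by rewrite (compE22 (esym (ru_nat _))) -tmorE lu_unit.
Qed.

End CentralFunctor.

(** * The unit algebra and its image *)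

Lemma unit_exact_algebra (k : fieldType) (C : ftcat k) : is_exact_algebra (unit_algebra C).
Proof.
apply: exact_algebra_of_split => p N pP.
have rE : ract N = ru N by have := ract1 N; rewrite /= tmor1 compm1.
exists (p ◃ ruV N); last by rewrite rE -wlM ruVK tmor1.
apply: equivariant_act; rewrite /equivariant /act_on /= rE ruK.
by rewrite triangle -wrM ruVK tmor1.
Qed.

(** By adjunction Hom(𝟙, R 𝟙) ≅ Hom(F 𝟙, 𝟙) ≅ End(𝟙), which consists of scalars; the line is spanned
    by [ra_F0 a]. *)
Lemma ra_unit_haploid (k : fieldType) (C : moncat k) (D : ftcat k) (F : tensor_functor C D)
    (R : functor D C) (a : adjunction F R) :
  is_haploid (lax_algebra (ra_laxmon a) (unit_algebra D)).
Proof.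
rewrite /is_haploid /=; have [g gK Kg] := ft_unit D.
have idE : F0V F ∘ F0 F = idm 𝟙 by case: (F0P F).
have spanF (w : hom 𝟙 (R 𝟙)) : exists c : k, w = c *: ra_F0 a.
  exists (g (transL a w ∘ F0 F)); apply: (transL_inj (a := a)).
  rewrite [RHS]/transL fmapZ compZr ra_F0E -[F0V F]comp1m -compZl (Kg (_ ∘ _)).
  by rewrite -compA F0VK compm1.
have nz : ra_F0 a != 0.
  apply/eqP => z; have /(can_inj gK)/eqP : 1 *: idm (𝟙 : D) = 0 *: idm (𝟙 : D).
    by rewrite scale1r scale0r -idE -(ra_F0E a) z fmap0 comp0r comp0l.
  by rewrite oner_eq0.
have <- : (<[ra_F0 a]> = {: hom 𝟙 (R 𝟙)})%VS.
  apply/eqP; rewrite eqEsubv subvf /=; apply/subvP => w _.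
  by have [c ->] := spanF w; rewrite memvZ ?memv_line.
by rewrite dim_vline nz.
Qed.

Theorem theorem4p26 (k : closedFieldType) (C D : pftcat k)
    (F : tensor_functor C D) (Fla Fra : functor D C)
    (adjl : adjunction Fla F) (adjr : adjunction F Fra) :
  is_pivotal F ->
  (is_tfrobenius adjl adjr ->
     forall A : algebra D,
       is_exact_algebra A -> has_symmetric_frobenius A ->
       is_exact_algebra (lax_algebra (ra_laxmon adjr) A) /\
       has_symmetric_frobenius (lax_algebra (ra_laxmon adjr) A)) /\
  (forall b : braiding C,
     central_structure b F -> is_frobenius Fla Fra ->
     let A := lax_algebra (ra_laxmon adjr) (unit_algebra D) in
     [/\ is_haploid A, is_commutative b A, is_exact_algebra A
       & has_symmetric_frobenius A]).
Proof.
move=> Fpiv; split.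
  move=> /tfrobenius_linear[b [bl br]] A Aex Asym; split.
    exact: (@ra_exact_algebra k C D F Fra adjr b A Aex).
  exact: (ra_symmetric_frobenius Fpiv bl br Asym).
move=> br cs [t ti]; pose b := iso_adjunction adjl ti.
(* Traces need a linear counit, so [b] is replaced by its left linearization; for exactness below,
   [b] itself serves. *)
have bl := lin_adjunction_left adjr b.
have bR := central_right_linear cs bl.
split; first exact: ra_unit_haploid.
- exact: ra_commutative cs _ _.
- exact: (@ra_exact_algebra k C D F Fra adjr b _ (@unit_exact_algebra k D)).
- exact: (ra_symmetric_frobenius Fpiv bl bR (unit_symmetric_frobenius D)).
Qed.
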